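(* Let $n\in\mathbb{N}$. There exists a constant $C>0$ such that for all $R\ge1$, all $0<\eta\le\frac1R$ and all $u\in L^2(\mathbb{T}^n)$ it holds $$\|u\|_{L^2(\mathbb{T}^n)}^2\le\frac{C}{R^2}\,\mathcal{E}_\eta(u)+C R^2\,\|u\|_{H^{-1}(\mathbb{T}^n)}^2,$$ where $$\mathcal{E}_\eta(u):=\frac14\int_{\mathbb{T}^n}\int_{\mathbb{T}^n}\tilde J_\eta(x-y)\,|u(x)-u(y)|^2\,dy\,dx .$$ (The constant $C$ is independent of $R,\eta,u$.)
   Context: $\mathbb{T}^n=\mathbb{R}^n/2\pi\mathbb{Z}^n$ is the $n$-dimensional torus; $H^{-1}(\mathbb{T}^n)$ is the dual space of $H^1(\mathbb{T}^n)=W^{1,2}(\mathbb{T}^n)$. Kernel. For $\eta>0$, $J_\eta:\mathbb{R}^n\to[0,\infty)$, $J_\eta(x)=\rho_\eta(|x|)/|x|^2$, with $J_\eta\in W^{1,1}(\mathbb{R}^n)$, where $\rho_\eta:\mathbb{R}\to[0,\infty)$, $\rho_\eta\in L^1(\mathbb{R})$, $\rho_\eta(r)=\rho_\eta(-r)$, $\rho_\eta(r)=\eta^{-n}\rho_1(r/\eta)$ for all $r\in\mathbb{R}$, $\int_0^\infty\rho_\eta(r)r^{n-1}\,dr=2/C_n$ for all $\eta>0$ with $C_n:=\int_{\mathbb{S}^{n-1}}|e_1\cdot\sigma|^2\,d\mathcal{H}^{n-1}(\sigma)$, $\lim_{\eta\searrow0}\int_{\kappa}^\infty\rho_\eta(r)r^{n-1}\,dr=0$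 for all $\kappa>0$, and $\rho_1$ is compactly supported in $(-\pi,\pi)$. $\tilde J_\eta:\mathbb{T}^n\to[0,\infty)$ is the $2\pi$-periodic extension of $J_\eta$. *)

(* Defs.v *)
From HB Require Import structures.
From mathcomp Require Import all_boot all_order all_algebra.
From mathcomp Require Import all_classical all_reals all_analysis.

Set Implicit Arguments.
Unset Strict Implicit.
Unset Printing Implicit Defensive.

Import Order.TTheory GRing.Theory Num.Theory.
Import numFieldNormedType.Exports.

Local Open Scope classical_set_scope.
Local Open Scope ring_scope.

Definition measure_rV_display : measure_display.
Proof. exact: default_measure_display. Qed.

(* Borel sets of R^n: as for n.-tuple, the sigma-algebra generated by the
   coordinates. *)
Section measurable_rV.
Context (R : realType) (n : nat).

Definition coord_rV (i : 'I_n) (x : 'rV[R]_n) : R := x ord0 i.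

Let rV_set0 : g_sigma_preimage coord_rV set0.
Proof. exact: sigma_algebra0. Qed.

Let rV_setC A : g_sigma_preimage coord_rV A -> g_sigma_preimage coord_rV (~` A).
Proof. exact: sigma_algebraC. Qed.

Let rV_bigcup (F : (set 'rV[R]_n)^nat) :
  (forall i, g_sigma_preimage coord_rV (F i)) ->
  g_sigma_preimage coord_rV (\bigcup_i (F i)).
Proof. exact: sigma_algebra_bigcup. Qed.

HB.instance Definition _ := @isMeasurable.Build measure_rV_display
  'rV[R]_n (g_sigma_preimage coord_rV) rV_set0 rV_setC rV_bigcup.

End measurable_rV.

Section measurable_rV_lemmas.
Context (R : realType) (n : nat).

Lemma measurable_coord_rV (i : 'I_n) :
  measurable_fun [set: 'rV[R]_n] (@coord_rV R n i).
Proof.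
move=> _ Y mY; rewrite setTI; apply: sub_sigma_algebra => /=.
rewrite -bigcup_seq/=; exists i => /=; first by rewrite mem_index_enum.
by exists Y => //; rewrite setTI.
Qed.

Lemma measurable_fun_rVP d (T : measurableType d) (f : T -> 'rV[R]_n) :
  (forall i, measurable_fun [set: T] (coord_rV i \o f)) ->
  measurable_fun [set: T] f.
Proof.
move=> mf _ A mA; rewrite setTI.
have : g_sigma_preimage (fun i => coord_rV i \o f) (f @^-1` A).
  by rewrite g_sigma_preimage_comp; exists A; rewrite ?setTI.
move: (f @^-1` A); apply: smallest_sub; first exact: sigma_algebra_measurable.
rewrite -bigcup_seq; apply: bigcup_sub => i _.
by move=> B [C mC <-]; exact: mf.
Qed.

End measurable_rV_lemmas.

Section lebesgue_rV_step.
Context (R : realType) (n : nat).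

Definition cons_rV (p : R * 'rV[R]_n) : 'rV[R]_n.+1 :=
  \row_i (if unlift ord0 i is Some j then p.2 ord0 j else p.1).

Definition uncons_rV (x : 'rV[R]_n.+1) : R * 'rV[R]_n :=
  (x ord0 ord0, \row_j x ord0 (lift ord0 j)).

Lemma cons_rVK : cancel cons_rV uncons_rV.
Proof.
move=> [a x]; rewrite /uncons_rV /cons_rV !mxE unlift_none; congr pair.
by apply/rowP => j; rewrite !mxE liftK.
Qed.

Lemma measurable_cons_rV : measurable_fun [set: R * 'rV[R]_n] cons_rV.
Proof.
apply: measurable_fun_rVP => i; case: (unliftP ord0 i) => [j|] ->.
- rewrite (_ : _ \o _ = @coord_rV R n j \o snd); last first.
    by apply/funext => p /=; rewrite /coord_rV mxE liftK.
  by apply: measurableT_comp => //; exact: measurable_coord_rV.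
- rewrite (_ : _ \o _ = fst)//.
  by apply/funext => p /=; rewrite /coord_rV mxE unlift_none.
Qed.

Lemma measurable_uncons_rV : measurable_fun [set: 'rV[R]_n.+1] uncons_rV.
Proof.
apply/measurable_fun_pairP; split => /=; first exact: measurable_coord_rV.
apply: measurable_fun_rVP => j.
rewrite (_ : _ \o _ = @coord_rV R n.+1 (lift ord0 j)).
  exact: measurable_coord_rV.
by apply/funext => x /=; rewrite /coord_rV mxE.
Qed.

Variable m : {sigma_finite_measure set 'rV[R]_n -> \bar R}.

Definition lebesgue_rV_step : set 'rV[R]_n.+1 -> \bar R :=
  pushforward (@lebesgue_measure R \x m)%E cons_rV.

Let step0 : lebesgue_rV_step set0 = 0%E.
Proof. by rewrite /lebesgue_rV_step /pushforward preimage_set0 measure0. Qed.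

Let step_ge0 A : (0 <= lebesgue_rV_step A)%E.
Proof. by rewrite /lebesgue_rV_step /pushforward measure_ge0. Qed.

Let step_sigma_additive : semi_sigma_additive lebesgue_rV_step.
Proof.
move=> F mF tF mUF; rewrite /lebesgue_rV_step /pushforward preimage_bigcup.
apply: measure_semi_sigma_additive.
- by move=> k; rewrite -[X in measurable X]setTI; exact: measurable_cons_rV.
- apply/trivIsetP => /= i j _ _ ij; rewrite -preimage_setI.
  by move/trivIsetP : tF => /(_ _ _ _ _ ij) ->//; rewrite preimage_set0.
- rewrite -preimage_bigcup -[X in measurable X]setTI.
  exact: measurable_cons_rV.
Qed.

HB.instance Definition _ := isMeasure.Build _ _ _ lebesgue_rV_step
  step0 step_ge0 step_sigma_additive.

Let step_sigma_finite : sigma_finite setT lebesgue_rV_step.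
Proof.
have /sigma_finiteP[F [FT ndF Foo]] := sigma_finiteT (@lebesgue_measure R).
have /sigma_finiteP[G [GT ndG Goo]] := sigma_finiteT m.
exists (fun k => uncons_rV @^-1` (F k `*` G k)).
  rewrite -preimage_bigcup -[LHS](preimage_setT uncons_rV); congr preimage.
  apply/seteqP; split=> // -[a x] _.
  have [i _ Fia] : (\bigcup_i F i) a by rewrite -FT.
  have [j _ Gjx] : (\bigcup_i G i) x by rewrite -GT.
  exists (maxn i j) => //; split => /=.
    by have /subsetPset := ndF _ _ (leq_maxl i j); apply.
  by have /subsetPset := ndG _ _ (leq_maxr i j); apply.
move=> k; have [mF Fk] := Foo k; have [mG Gk] := Goo k; split.
  rewrite -[X in measurable X]setTI; apply: measurable_uncons_rV => //.
  exact: measurableX.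
rewrite /lebesgue_rV_step /pushforward -comp_preimage.
rewrite (_ : uncons_rV \o cons_rV = id); last first.
  by apply/funext => p; exact: cons_rVK.
rewrite preimage_id product_measure1E//.
by rewrite lte_mul_pinfty// ge0_fin_numE.
Qed.

HB.instance Definition _ := @Measure_isSigmaFinite.Build _ _ _ lebesgue_rV_step
  step_sigma_finite.

End lebesgue_rV_step.

(* Lebesgue measure on R^n, as the n-fold product of lebesgue_measure. *)
Fixpoint lebesgue_rV (R : realType) (n : nat) :
    {sigma_finite_measure set 'rV[R]_n -> \bar R} :=
  match n with
  | 0 => dirac (0 : 'rV[R]_0)
  | n'.+1 => [the {sigma_finite_measure set 'rV[R]_n'.+1 -> \bar R} of
      lebesgue_rV_step (lebesgue_rV R n')]
  end.

Section euclidean_space.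
Context {R : realType} {n : nat}.
Implicit Types (x y : 'rV[R]_n) (f phi : 'rV[R]_n -> R) (A : set 'rV[R]_n).

Definition dotr x y : R := \sum_i x ord0 i * y ord0 i.

(* The Euclidean norm; `|x| is the sup norm on 'rV[R]_n. *)
Definition enorm x : R := Num.sqrt (dotr x x).

Definition partial (i : 'I_n) f : 'rV[R]_n -> R := 'D_(delta_mx ord0 i) f.

Definition iter_partial (s : seq 'I_n) f : 'rV[R]_n -> R := foldr partial f s.

Definition smooth f : Prop := forall s : seq 'I_n,
  continuous (iter_partial s f) /\
  forall (i : 'I_n) x, derivable (iter_partial s f) x (delta_mx ord0 i).

Definition compactly_supported f : Prop :=
  compact (closure [set x | f x != 0]).

Definition periodic f : Prop :=
  forall (i : 'I_n) x, f (x + (2 * pi) *: delta_mx ord0 i) = f x.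

Definition weak_gradient (mu : {measure set 'rV[R]_n -> \bar R})
    (D : set ('rV[R]_n -> R)) f (g : 'I_n -> 'rV[R]_n -> R) : Prop :=
  forall phi, D phi -> forall i,
    \int[mu]_x (f x * partial i phi x) = - \int[mu]_x (g i x * phi x).

Definition sobolev_W11 f : Prop :=
  f \in Lfun (lebesgue_rV R n) 1%:E /\
  exists2 g : 'I_n -> 'rV[R]_n -> R,
    forall i, g i \in Lfun (lebesgue_rV R n) 1%:E &
    weak_gradient (lebesgue_rV R n)
      [set phi | smooth phi /\ compactly_supported phi] f g.

End euclidean_space.

(* Hausdorff measure of integer dimension m on R^n, normalized so that it is
   Lebesgue measure for m = n. It is defined on all subsets of R^n, hence only
   as an outer measure. *)
Section hausdorff_measure.
Context {R : realType} {n : nat}.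
Implicit Types A : set 'rV[R]_n.
Local Open Scope ereal_scope.

Definition unit_ball_volume (m : nat) : \bar R :=
  lebesgue_rV R m [set x | enorm x <= 1]%R.

Definition diameter A : \bar R :=
  ereal_sup [set (enorm (p.1 - p.2))%:E | p in A `*` A].

Definition hausdorff_gauge (m : nat) A : \bar R :=
  if A == set0 then 0
  else unit_ball_volume m * ((2^-1)%:E * diameter A) ^+ m.

Definition hausdorff_content (m : nat) (delta : R) A : \bar R :=
  ereal_inf [set \sum_(k <oo) hausdorff_gauge m (F k) |
    F in [set F : (set 'rV[R]_n)^nat |
      (forall k, diameter (F k) <= delta%:E) /\ A `<=` \bigcup_k F k]].

Definition hausdorff (m : nat) A : \bar R :=
  ereal_sup [set hausdorff_content m delta A | delta in [set d | (0 < d)%R]].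

End hausdorff_measure.

(* Functions on the torus are represented by 2pi-periodic functions on R^n, and
   its measure by Lebesgue measure on the cell [-pi, pi[^n. *)
Section torus.
Context {R : realType} {n : nat}.
Implicit Types (x : 'rV[R]_n) (f u v : 'rV[R]_n -> R).

Definition torus_cell : set 'rV[R]_n :=
  [set x | forall i, - pi <= x ord0 i < pi].

Lemma measurable_torus_cell : measurable torus_cell.
Proof.
rewrite (_ : torus_cell =
    \bigcap_(i in [set: 'I_n]) (@coord_rV R n i @^-1` `[- pi, pi[%classic)).
  apply: fin_bigcap_measurable => // i _.
  rewrite -[X in measurable X]setTI.
  exact: measurable_coord_rV.
apply/seteqP; split=> x /= h i; first by move=> _; rewrite /= in_itv; exact: h.
by have := h i I; rewrite /= in_itv.
Qed.

Definition lebesgue_torus : {measure set 'rV[R]_n -> \bar R} :=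
  mrestr (lebesgue_rV R n) measurable_torus_cell.

(* The representative in the cell of the class of x modulo 2pi Z^n. *)
Definition torus_repr x : 'rV[R]_n :=
  \row_i (x ord0 i
    - 2 * pi * (Num.floor ((x ord0 i + pi) / (2 * pi)))%:~R).

Definition periodic_extension f : 'rV[R]_n -> R := f \o torus_repr.

Definition L2_torus u : Prop :=
  periodic u /\ u \in Lfun lebesgue_torus 2%:E.

Definition L2_norm u : \bar R := ('N[lebesgue_torus]_2%:E [EFin \o u])%E.

(* H^1(T^n), a function being paired with its weak gradient g, which is unique
   up to equality almost everywhere. *)
Definition H1_torus v (g : 'I_n -> 'rV[R]_n -> R) : Prop :=
  [/\ L2_torus v, forall i, L2_torus (g i) &
      weak_gradient lebesgue_torus
        [set phi | smooth phi /\ periodic phi] v g].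

Definition H1_norm v (g : 'I_n -> 'rV[R]_n -> R) : \bar R :=
  ((L2_norm v ^+ 2 + \sum_i L2_norm (g i) ^+ 2) `^ 2^-1)%E.

(* The dual norm of the functional induced by u through the L^2 pairing. *)
Definition Hm1_norm u : \bar R :=
  ereal_sup [set `| \int[lebesgue_torus]_x (u x * p.1 x) |%:E |
    p in [set p : ('rV[R]_n -> R) * ('I_n -> 'rV[R]_n -> R) |
      H1_torus p.1 p.2 /\ (H1_norm p.1 p.2 <= 1)%E]].

End torus.

Section kernel.
Context {R : realType} (n : nat) (rho : R -> R -> R).

Definition e1 : 'rV[R]_n := \row_i (i == 0 :> nat)%:R.

Definition C_sphere : \bar R :=
  (\int[hausdorff n.-1]_(s in [set s : 'rV[R]_n | enorm s = 1%R])
     (`|dotr e1 s| ^+ 2)%:E)%E.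

Definition J (eta : R) (x : 'rV[R]_n) : R :=
  rho eta (enorm x) / enorm x ^+ 2.

(* C_sphere lies in ]0, +oo[ but is an extended real: the condition that the
   integral in rho_normalized equals 2 / C_sphere is multiplied out, so as not
   to depend on the conventions for division in \bar R. *)
Record admissible_kernel : Prop := AdmissibleKernel {
  rho_ge0 : forall eta r : R, 0 < eta -> 0 <= rho eta r;
  rho_L1 : forall eta : R, 0 < eta -> rho eta \in Lfun (@lebesgue_measure R) 1%:E;
  rho_even : forall eta r : R, 0 < eta -> rho eta r = rho eta (- r);
  rho_scaling : forall eta r : R, 0 < eta -> rho eta r = eta ^- n * rho 1 (r / eta);
  rho_normalized : forall eta : R, 0 < eta ->
    (C_sphere * \int[lebesgue_measure]_(r in `[0%R, +oo[)
      (rho eta r * r ^+ n.-1)%:E = 2%:E)%E;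
  rho_concentrates : forall kappa : R, 0 < kappa ->
    (\int[lebesgue_measure]_(r in `[kappa, +oo[)
      (rho eta r * r ^+ n.-1)%:E)%E @[eta --> 0^'+] --> 0%E;
  rho1_support : compact (closure [set r | rho 1 r != 0]) /\
    closure [set r | rho 1 r != 0] `<=` `]- pi, pi[;
  J_W11 : forall eta : R, 0 < eta -> sobolev_W11 (J eta) }.

Definition energy (eta : R) (u : 'rV[R]_n -> R) : \bar R :=
  ((4^-1)%:E * \int[lebesgue_torus]_x \int[lebesgue_torus]_y
    (periodic_extension (J eta) (x - y) * `|u x - u y| ^+ 2)%:E)%E.

End kernel.

(* Main.v *)
Require Import Defs.
From HB Require Import structures.
From mathcomp Require Import all_boot all_order all_algebra.
From mathcomp Require Import all_classical all_reals all_analysis.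
From mathcomp Require Import measurable_realfun measurable_fun_approximation.
From mathcomp Require Import ring lra.

Set Implicit Arguments.
Unset Strict Implicit.
Unset Printing Implicit Defensive.

Import Order.TTheory GRing.Theory Num.Theory.
Import numFieldNormedType.Exports.
Local Open Scope classical_set_scope.
Local Open Scope ring_scope.

(** Write |u|^2 for the integral of u^2 over the torus, E for the energy of u at
    scale eta, and w(h) for the translation defect, that is the integral of
    (u(x + h) - u(x))^2 over the torus.  The high frequencies of u are controlled
    by translation defects at scale 1/R, the low ones by duality.

    Translation defects.  The normalisation forces the profile at scale 1 to be
    positive on a set of positive measure, so J_1 is at least some c > 0 on a
    set A of positive measure (admissible_kernel_lower_bound).  For h small along
    a coordinate axis, A meets its translate by -h in at least half of its measure
    (lebesgue_overlap_half).  Averaging w(eta h) <= 2 w(eta (z + h)) + 2 w(eta z)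
    over the z of this overlap, and comparing with the energy, which is one
    quarter of the integral of J_eta w, gives w(t e_i) <= C eta^2 E for
    |t| <= c eta (translation_defect_le_energy).  Since w(k h) <= k^2 w(h), taking
    k of order 1 / (eta R) carries this bound from scale eta to scale 1/R:
    w(t e_i) <= C R^-2 E for |t| <= c/R (translation_defect_le).

    High frequencies.  Let A u be the result of averaging u, successively in each
    coordinate direction, over segments of half-length d = c/R.  Then |u - A u|^2
    is at most a constant times the supremum of w(t e_i) over |t| <= d
    (averages_defect), hence at most C R^-2 E.

    Low frequencies.  If A' is the adjoint of A, then |A u|^2 is the pairing of u
    with v = A' A u.  Differentiating the average of a function along a segment
    gives a difference quotient, by the fundamental theorem of calculus; so v lies
    in H^1, and its squared norm there is at most (1 + n d^-2) |A u|^2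
    (weak_gradient_coaverages).  Hence |A u|^2 is at most (1 + n d^-2), which is of
    order R^2, times the squared dual norm of u (averages_sqr_le).

    The averages are applied to truncations of u: for bounded functions every
    exchange of integrals is legitimate.  Truncation decreases all translation
    defects, and the truncated functions converge to u in L^2 (truncate_cvg), so
    the estimate for u follows in the limit (interpolation_real). *)

(** * Lebesgue measure under affine maps of the line *)

Section restriction.
Context d (T : measurableType d) (R : realType).
Local Open Scope ereal_scope.

Lemma ge0_integral_mrestr (mu : {measure set T -> \bar R}) (D : set T)
    (mD : measurable D) (f : T -> \bar R) :
  measurable_fun [set: T] f -> (forall x, 0 <= f x) ->
  \int[mrestr mu mD]_x f x = \int[mu]_(x in D) f x.
Proof.
move=> mf f0.
have mDc : measurable (~` D) by exact: measurableC.
rewrite -(setUv D) ge0_integral_setU//=; last 2 first.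
- by rewrite setUv.
- by apply/disj_setPS; rewrite setICr.
rewrite [X in _ + X]null_set_integral//; last 2 first.
- exact: measurable_funTS.
- by have := measure0 mu; rewrite -(setICl D); apply.
rewrite adde0; apply: eq_measure_integral => A mA AD.
by rewrite /= /mrestr setIidl.
Qed.
End restriction.

Section affine_line.
Context (R : realType).
Notation leb := (@lebesgue_measure R).
Local Open Scope ereal_scope.

Definition affine_map (a b x : R) : measurableTypeR R := (a * x + b)%R.

Lemma measurable_affine_map a b : measurable_fun [set: R] (affine_map a b).
Proof. by apply: measurable_funD => //; exact: measurable_funM. Qed.

(** The image of Lebesgue measure under x |-> a x + b, rescaled by a: it agrees
    with Lebesgue measure on half-open intervals, hence everywhere. *)
Let affine_push (a : {nonneg R}) b : {measure set (measurableTypeR R) -> \bar R} :=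
  mscale a (measure_function_pushforward__canonical__measure_function_Measure
    leb (measurable_affine_map a%:num b)).

Let lebesgue_measure_affine (a : {nonneg R}) (b : R) (A : set R) :
  (0 < a%:num)%R -> measurable A -> lebesgue_measure A = affine_push a b A.
Proof.
move=> a0; apply: lebesgue_measure_unique => _ [[c d]] _ <- /=.
transitivity (a%:num%:E * leb (affine_map a%:num b @^-1` `]c, d]%classic)) => //.
rewrite (_ : _ @^-1` _ = `](c - b) / a%:num, (d - b) / a%:num]%classic)%R.
  rewrite !lebesgue_measure_itv/= !lte_fin ltr_pM2r ?invr_gt0// ltrD2r.
  case: ifPn => cd; last by rewrite mule0.
  rewrite -!EFinB -EFinM; congr EFin; field.
  by rewrite gt_eqF.
apply/seteqP; split => x /=; rewrite /affine_map !in_itv/=;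
  by rewrite ltr_pdivrMr// ler_pdivlMr// ltrBlDr lerBrDr (mulrC x).
Qed.

Lemma ge0_integral_affine (a b : R) (f : R -> \bar R) : (0 < a)%R ->
  measurable_fun [set: R] f -> (forall x, 0 <= f x) ->
  a%:E * \int[leb]_x f (a * x + b)%R = \int[leb]_x f x.
Proof.
move=> a0 mf f0; pose an := NngNum (ltW a0).
rewrite [RHS](eq_measure_integral (affine_push an b)); last first.
  by move=> A mA _; exact: lebesgue_measure_affine.
rewrite ge0_integral_mscale//=.
by congr (_ * _); rewrite ge0_integral_pushforward//; exact: measurable_affine_map.
Qed.
End affine_line.

(** * Slicing Lebesgue measure along the first coordinate *)

Section row_vectors.
Context (R : realType).
Notation leb := (@lebesgue_measure R).
Local Open Scope ereal_scope.

Lemma measurable_fun_rVD d (T : measurableType d) n (f g : T -> 'rV[R]_n) :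
  measurable_fun [set: T] f -> measurable_fun [set: T] g ->
  measurable_fun [set: T] (fun x => f x + g x)%R.
Proof.
move=> mf mg; apply: measurable_fun_rVP => i.
rewrite (_ : _ \o _ = (coord_rV i \o f) \+ (coord_rV i \o g))%R; last first.
  by apply/funext => x; rewrite /= /coord_rV mxE.
by apply: measurable_funD; apply: measurableT_comp => //; exact: measurable_coord_rV.
Qed.

Lemma measurable_fun_rVZ d (T : measurableType d) n (k : T -> R) (f : T -> 'rV[R]_n) :
  measurable_fun [set: T] k -> measurable_fun [set: T] f ->
  measurable_fun [set: T] (fun x => k x *: f x)%R.
Proof.
move=> mk mf; apply: measurable_fun_rVP => i.
rewrite (_ : _ \o _ = k \* (coord_rV i \o f))%R; last first.
  by apply/funext => x; rewrite /= /coord_rV mxE.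
by apply: measurable_funM => //; apply: measurableT_comp => //; exact: measurable_coord_rV.
Qed.

Lemma measurable_fun_rVN d (T : measurableType d) n (f : T -> 'rV[R]_n) :
  measurable_fun [set: T] f -> measurable_fun [set: T] (fun x => - f x)%R.
Proof.
move=> mf; rewrite (_ : (fun _ => _) = (fun x => (-1) *: f x)%R).
  exact: measurable_fun_rVZ.
by apply/funext => x; rewrite scaleN1r.
Qed.

Section recursion.
Variables (n : nat) (f : 'rV[R]_n.+1 -> \bar R).
Hypotheses (mf : measurable_fun [set: 'rV_n.+1] f) (f0 : forall x, 0 <= f x).

Let mfc : measurable_fun [set: R * 'rV_n] (f \o @cons_rV R n).
Proof. by apply: measurableT_comp => //; exact: measurable_cons_rV. Qed.

Let pushE : \int[lebesgue_rV R n.+1]_x f x =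
  \int[leb \x lebesgue_rV R n]_p f (cons_rV p).
Proof.
by rewrite [LHS]ge0_integral_pushforward//; exact: measurable_cons_rV.
Qed.

Lemma ge0_integral_rVS : \int[lebesgue_rV R n.+1]_x f x =
  \int[leb]_a \int[lebesgue_rV R n]_x f (cons_rV (a, x)).
Proof.
by rewrite pushE fubini_tonelli1//= => p; exact: f0.
Qed.

Lemma ge0_integral_rVS_swap : \int[lebesgue_rV R n.+1]_x f x =
  \int[lebesgue_rV R n]_x \int[leb]_a f (cons_rV (a, x)).
Proof.
by rewrite pushE fubini_tonelli2//= => p; exact: f0.
Qed.

Lemma measurable_cons_sectionr a :
  measurable_fun [set: 'rV_n] (fun x => f (cons_rV (a, x))).
Proof. exact: (measurableT_comp mfc (measurable_pair1 a)). Qed.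

Lemma measurable_integral_sectionr :
  measurable_fun [set: R] (fun a => \int[lebesgue_rV R n]_x f (cons_rV (a, x))).
Proof.
exact: (@measurable_fun_fubini_tonelli_F _ _ _ _ _ (lebesgue_rV R n) _ mfc (fun p => f0 (cons_rV p))).
Qed.

Lemma measurable_integral_sectionl :
  measurable_fun [set: 'rV_n] (fun x => \int[leb]_a f (cons_rV (a, x))).
Proof.
exact: (@measurable_fun_fubini_tonelli_G _ _ (measurableTypeR R) _ _ leb
  (f \o @cons_rV R n) mfc (fun p => f0 (cons_rV p))).
Qed.

End recursion.

Lemma cons_rV_affine n (k a b : R) (x y : 'rV[R]_n) :
  (k *: cons_rV (a, x) + cons_rV (b, y) = cons_rV (k * a + b, k *: x + y))%R.
Proof.
by apply/rowP => i; rewrite !mxE; case: unlift => [j|]; rewrite ?mxE.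
Qed.

Lemma uncons_rVK n (x : 'rV[R]_n.+1) : cons_rV (uncons_rV x) = x.
Proof.
by apply/rowP => i; rewrite !mxE; case: unliftP => [j ->|->] //=; rewrite mxE.
Qed.

(** By induction on the dimension, one slice at a time: the first coordinate gives
    one factor k, the induction hypothesis gives the others. *)
Lemma ge0_integral_rV_affine n (k : R) (b : 'rV[R]_n) (f : 'rV[R]_n -> \bar R) :
  (0 < k)%R -> measurable_fun [set: 'rV_n] f -> (forall x, 0 <= f x) ->
  (k ^+ n)%:E * \int[lebesgue_rV R n]_x f (k *: x + b)%R =
  \int[lebesgue_rV R n]_x f x.
Proof.
move=> k0; elim: n b f => [|n IH] b f mf f0.
  rewrite expr0 mul1e; apply: eq_integral => x _; congr f.
  by apply/rowP => -[].
rewrite -[b]uncons_rVK; case: (uncons_rV b) => {b} b0 b.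
pose g x := f (k *: x + cons_rV (b0, b))%R.
have mg : measurable_fun [set: 'rV_n.+1] g.
  apply: measurableT_comp => //; apply: measurable_fun_rVD => //.
  exact: measurable_fun_rVZ.
rewrite ge0_integral_rVS//.
rewrite [RHS]ge0_integral_rVS// -[RHS](ge0_integral_affine b0 k0); last 2 first.
- exact: measurable_integral_sectionr.
- by move=> a; apply: integral_ge0.
rewrite exprS EFinM -muleA; congr (_ * _).
rewrite -ge0_integralZl//; last 3 first.
- exact: (measurable_integral_sectionr mg (fun x => f0 _)).
- by move=> a _; apply: integral_ge0 => x _; exact: f0.
- by rewrite lee_fin exprn_ge0// ltW.
apply: eq_integral => a _.
rewrite -[RHS](IH b)//; last exact: measurable_cons_sectionr.
by congr (_ * _); apply: eq_integral => x _; rewrite cons_rV_affine.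
Qed.

End row_vectors.

(** * The torus and its translations *)

Section circle.
Context (R : realType).
Notation leb := (@lebesgue_measure R).
Local Open Scope ereal_scope.

Definition circle_cell : set R := `[(- pi)%R, pi%R[%classic.

Lemma ge0_integral_itv_shift (c d c' d' t : R) (h : R -> \bar R) :
  measurable_fun [set: R] h -> (forall x, 0 <= h x) ->
  c' = (c + t)%R -> d' = (d + t)%R ->
  \int[leb]_(x in `[c, d[) h (x + t)%R = \int[leb]_(x in `[c', d'[) h x.
Proof.
move=> mh h0 -> ->; rewrite integral_mkcond [RHS]integral_mkcond.
rewrite -[RHS](ge0_integral_affine t ltr01); last 2 first.
- by apply/(measurable_restrictT _ _).1 => //; exact: measurable_funTS.
- by move=> x; exact: erestrict_ge0.
rewrite mul1e; apply: eq_integral => x _.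
by rewrite mul1r /patch !mem_setE !in_itv/= lerD2r ltrD2r.
Qed.

Lemma periodic_int T (h : R -> T) (p : R) : (forall x, h (x + p)%R = h x) ->
  forall (k : int) x, h (x + p * k%:~R)%R = h x.
Proof.
move=> hp; have hn m x : h (x + p * m%:R)%R = h x.
  elim: m x => [|m IH] x; first by rewrite mulr0 addr0.
  by rewrite -natr1 mulrDr mulr1 addrA hp.
case=> m x; first exact: hn.
by rewrite NegzE mulrNz mulrN -(hn m.+1) subrK.
Qed.

(** The shifted cell [t - pi, t + pi[ contains a point p congruent to -pi modulo
    2 pi.  Cutting it at p and moving the left piece by one period turns it into
    [p, p + 2 pi[, a translate of the cell by a multiple of the period. *)
Lemma ge0_integral_circle_shift (t : R) (h : R -> \bar R) :
  measurable_fun [set: R] h -> (forall x, 0 <= h x) ->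
  (forall x, h (x + 2 * pi)%R = h x) ->
  \int[leb]_(x in circle_cell) h (x + t)%R = \int[leb]_(x in circle_cell) h x.
Proof.
move=> mh h0 hp; rewrite /circle_cell (ge0_integral_itv_shift mh h0 erefl erefl).
have pi2 : (0 < 2 * pi :> R)%R by rewrite mulr_gt0// pi_gt0.
pose k := Num.ceil (t / (2 * pi)); pose p : R := (- pi + 2 * pi * k%:~R)%R.
have kt : (t <= 2 * pi * k%:~R)%R.
  by rewrite mulrC -ler_pdivrMr// ceil_ge.
have tk : (2 * pi * k%:~R < t + 2 * pi)%R.
  rewrite -ltrBlDr -[X in (_ - X)%R]mulr1 -mulrBr mulrC -ltr_pdivlMr//.
  by have := ceilB1_lt (t / (2 * pi)); rewrite intrB.
have -> : \int[leb]_(x in `[(- pi)%R, pi%R[) h x = \int[leb]_(x in `[p, (p + 2 * pi)%R[) h x.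
  under eq_integral do rewrite -(periodic_int hp k).
  by apply: ge0_integral_itv_shift => //; rewrite /p; lra.
have split (a b c : R) : (a <= b)%R -> (b <= c)%R ->
    \int[leb]_(x in `[a, c[) h x =
    \int[leb]_(x in `[a, b[) h x + \int[leb]_(x in `[b, c[) h x.
  move=> ab bc; rewrite -ge0_integral_setU//=; last 2 first.
  - exact: measurable_funTS.
  - by apply/disj_setPS => x/= []; rewrite !in_itv/= => /andP[_ xb] /andP[/(lt_le_trans xb)]; rewrite ltxx.
  by congr integral; rewrite -itv_bndbnd_setU// ?bnd_simp.
rewrite (split _ p); [|rewrite /p; lra..].
rewrite [RHS](split _ (pi + t)%R); [|rewrite /p; lra..].
rewrite addeC; congr (_ + _).
under eq_integral do rewrite -hp.
by apply: ge0_integral_itv_shift => //; rewrite /p; lra.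
Qed.

End circle.
Arguments circle_cell {R}.

Section torus_measure.
Context (R : realType).
Notation leb := (@lebesgue_measure R).
Local Open Scope ereal_scope.

Lemma torus_cell_cons n (a : R) (x : 'rV[R]_n) :
  torus_cell (cons_rV (a, x)) <-> circle_cell a /\ torus_cell x.
Proof.
rewrite /torus_cell /circle_cell /= in_itv/=; split.
  move=> h; split; first by have := h ord0; rewrite mxE unlift_none.
  by move=> i; have := h (lift ord0 i); rewrite mxE liftK.
by move=> [ha hx] i; rewrite mxE; case: unliftP => [j _|_] //=.
Qed.

Lemma ge0_integral_torusE n (f : 'rV[R]_n -> \bar R) :
  measurable_fun [set: 'rV_n] f -> (forall x, 0 <= f x) ->
  \int[lebesgue_torus]_x f x = \int[lebesgue_rV R n]_(x in torus_cell) f x.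
Proof. exact: ge0_integral_mrestr. Qed.

Lemma ge0_integral_torusS n (f : 'rV[R]_n.+1 -> \bar R) :
  measurable_fun [set: 'rV_n.+1] f -> (forall x, 0 <= f x) ->
  \int[lebesgue_torus]_x f x =
  \int[leb]_(a in circle_cell) \int[lebesgue_torus]_x f (cons_rV (a, x)).
Proof.
move=> mf f0; rewrite ge0_integral_torusE// integral_mkcond.
have mfr : measurable_fun [set: 'rV_n.+1] (f \_ torus_cell).
  apply/(measurable_restrictT _ _).1; first exact: measurable_torus_cell.
  exact: measurable_funTS.
rewrite (ge0_integral_rVS mfr); last by move=> x; exact: erestrict_ge0.
rewrite [RHS]integral_mkcond; apply: eq_integral => a _.
rewrite patchE; case: ifPn => [/set_mem|/negP] Ia.
  rewrite ge0_integral_torusE//; last exact: measurable_cons_sectionr.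
  rewrite [RHS]integral_mkcond; apply: eq_integral => x _.
  rewrite !patchE; case: ifPn => /= [/set_mem/torus_cell_cons[_ ?]|xT].
    by rewrite ifT// inE.
  rewrite ifF//; apply: contraNF xT => /set_mem xT; apply/mem_set.
  by apply/torus_cell_cons.
apply: integral0_eq => x _; rewrite patchE ifF//.
by apply/negP => /set_mem/torus_cell_cons[/mem_set].
Qed.

Lemma lebesgue_torusT n : @lebesgue_torus R n setT = ((2 * pi) ^+ n)%:E.
Proof.
rewrite -[LHS]mul1e -integral_cst//.
elim: n => [|n IH].
  rewrite ge0_integral_torusE// integral_cst//; last exact: measurable_torus_cell.
  rewrite mul1e expr0 /= diracE mem_set//= => -[].
  by case.
rewrite ge0_integral_torusS//.
transitivity (\int[leb]_(a in circle_cell) ((2 * pi) ^+ n)%:E).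
  by apply: eq_integral => a _; rewrite -IH.
rewrite integral_cst; last exact: measurable_itv.
transitivity (((2 * pi) ^+ n)%:E * (2 * pi)%:E : \bar R); last first.
  by rewrite -EFinM exprSr.
congr (_ * _).
rewrite /= lebesgue_measure_itv/= lte_fin gt0_cp ?pi_gt0//.
by rewrite -EFinB; congr EFin; lra.
Qed.

(** The measure of the torus under a second name, which carries the structure of a
    finite measure: products of measures and Fubini's theorem require it. *)
Definition torus n : set 'rV[R]_n -> \bar R := @lebesgue_torus R n.

HB.instance Definition _ n := Measure.copy (@torus n) (@lebesgue_torus R n).

Lemma torus_fin n : fin_num_fun (@torus n).
Proof.
move=> A mA; rewrite ge0_fin_numE//; apply: (@le_lt_trans _ _ (@torus n setT)).
  by apply: le_measure => //; rewrite inE.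
by rewrite /torus lebesgue_torusT ltry.
Qed.

HB.instance Definition _ n := @Measure_isFinite.Build _ _ _ (@torus n) (@torus_fin n).

(** Slicing the torus along its first coordinate leaves a shift of the circle and,
    by induction, a translation of a torus of lower dimension. *)
Lemma ge0_integral_torus_translate n (b : 'rV[R]_n) (f : 'rV[R]_n -> \bar R) :
  measurable_fun [set: 'rV_n] f -> (forall x, 0 <= f x) ->
  (forall i x, f (x + (2 * pi) *: delta_mx ord0 i)%R = f x) ->
  \int[lebesgue_torus]_x f (x + b)%R = \int[lebesgue_torus]_x f x.
Proof.
elim: n b f => [|n IH] b f mf f0 fp.
  by apply: eq_integral => x _; congr f; apply/rowP => -[].
have mfb : measurable_fun [set: 'rV_n.+1] (fun x => f (x + b)%R).
  by apply: measurableT_comp => //; exact: measurable_fun_rVD.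
rewrite (ge0_integral_torusS mfb (fun x => f0 _)) (ge0_integral_torusS mf f0).
rewrite -[b]uncons_rVK; case: (uncons_rV b) => b0 b'.
have consD a x : (cons_rV (a, x) + cons_rV (b0, b') = cons_rV (a + b0, x + b'))%R.
  by rewrite -[cons_rV (a, x)]scale1r cons_rV_affine mul1r scale1r.
rewrite -[RHS](ge0_integral_circle_shift b0); last 3 first.
- apply: (@measurable_fun_fubini_tonelli_F _ _ _ _ _ (@torus n) (f \o @cons_rV R n)) => //.
    by apply: measurableT_comp => //; exact: measurable_cons_rV.
  by move=> p; exact: f0.
- by move=> a; apply: integral_ge0.
- move=> a; apply: eq_integral => x _; rewrite -[RHS](fp ord0); congr f.
  apply/rowP => i; rewrite !mxE; case: unliftP => [j ->|->]/=; first by rewrite mulr0 addr0.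
  by rewrite mulr1.
apply: eq_integral => a _; under eq_integral do rewrite consD.
apply: (IH b' (fun x => f (cons_rV (a + b0, x))%R)) => //.
  exact: measurable_cons_sectionr.
move=> i x; rewrite -[RHS](fp (lift ord0 i)); congr f.
apply/rowP => k; rewrite !mxE; case: unliftP => [j ->|->]/=.
  by rewrite !mxE/= (inj_eq lift_inj).
by rewrite mulr0 addr0.
Qed.

End torus_measure.

(** * Overlap of a set with its translates *)

Lemma measure_indicE d (T : measurableType d) (R : realType)
    (mu : {measure set T -> \bar R}) (A : set T) : measurable A ->
  mu A = (\int[mu]_x (\1_A x)%:E)%E.
Proof. by move=> mA; rewrite integral_indic// setIT. Qed.

Section overlap.
Context (R : realType).
Notation leb := (@lebesgue_measure R).
Local Open Scope ereal_scope.

Lemma measurable_preimage_shift (A : set R) (t : R) : measurable A ->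
  measurable [set x | A (x + t)%R].
Proof.
move=> mA; rewrite -[X in measurable X]setTI.
exact: (measurable_funD (@measurable_id _ _ setT) (@measurable_cst _ _ _ _ setT t)).
Qed.

Lemma lebesgue_measure_shift (A : set R) (t : R) : measurable A ->
  leb [set x | A (x + t)%R] = leb A.
Proof.
move=> mA; have mAt := measurable_preimage_shift t mA.
rewrite (measure_indicE leb mA) (measure_indicE leb mAt).
rewrite -[RHS](ge0_integral_affine t ltr01)//; last exact/measurable_EFinP.
rewrite mul1e; apply: eq_integral => x _.
by rewrite mul1r !indicE.
Qed.

(** Regularity: choose a compact K inside A and an open U around K, both up to e/2
    in measure.  For t small, the translate of K by t stays inside U, because K is
    compact; it has the measure of K, so all of it but e/2 lies in K. *)
Lemma lebesgue_overlap1_ge (A : set R) (e : R) : measurable A -> leb A < +oo ->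
  (0 < e)%R ->
  \forall t \near (0:R)%R, leb A <= leb (A `&` [set x | A (x + t)%R]) + e%:E.
Proof.
move=> mA Aoo e0; have e20 : (0 < e / 2)%R by rewrite divr_gt0.
have [K [cK KA AKe]] := lebesgue_regularity_inner mA Aoo e20.
have mK : measurable K by exact: compact_measurable.
have Koo : leb K < +oo by apply: le_lt_trans Aoo; apply: le_measure; rewrite ?inE.
have [U [oU KU UKe]] := lebesgue_regularity_outer mK Koo e20.
have mU : measurable U by exact: open_measurable.
have : \forall t \near (0:R)%R, K `<=` [set x | U (x - t)%R].
  move/compact_near_coveringP : cK => cK.
  apply: (cK R (nbhs (0:R)%R) (fun t x => U (x - t)%R) _) => x Kx.
  have : (fun p : R * R => p.1 - p.2)%R p @[p --> (x, 0%R)] --> (x - 0)%R.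
    by apply: cvgB; [exact: cvg_fst|exact: cvg_snd].
  rewrite subr0 => /(_ U); apply.
  by apply: open_nbhs_nbhs; split => //; exact: KU.
apply: filterS => t KUt.
pose K' := [set x | K (x + t)%R].
have mK' : measurable K' by exact: measurable_preimage_shift.
have K'U : K' `<=` U by move=> x /KUt /=; rewrite addrK.
have -> : leb A = leb (K `|` (A `\` K)) by rewrite setDUK.
rewrite (splitr e) EFinD addeA.
apply: le_trans (measureU2 _ _ _) _ => //; first exact: measurableD.
apply: leeD; last exact: ltW.
apply: (@le_trans _ _ (leb K')).
  by rewrite [leb K'](lebesgue_measure_shift t mK).
rewrite -(setUIDK K' K).
apply: le_trans (measureU2 _ _ _) _; [exact: measurableI|exact: measurableD|].
apply: leeD; last first.
  apply: le_trans (ltW UKe); apply: le_measure; rewrite ?inE; try exact: measurableD.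
  exact: setSD.
apply: le_measure; rewrite ?inE; try apply: measurableI => //.
  exact: measurable_preimage_shift.
by move=> x [/= /KA ? /KA].
Qed.

Lemma lebesgue_overlap1_cvg (A : set R) (t_ : R^nat) : measurable A ->
  leb A < +oo -> t_ @ \oo --> (0:R)%R ->
  leb (A `&` [set x | A (x + t_ k)%R]) @[k --> \oo] --> leb A.
Proof.
move=> mA Aoo t0.
have Afin : leb A \is a fin_num by rewrite ge0_fin_numE.
have ub k : leb (A `&` [set x | A (x + t_ k)%R]) <= leb A.
  apply: le_measure; rewrite ?inE//.
  by apply: measurableI => //; exact: measurable_preimage_shift.
have fin k : leb (A `&` [set x | A (x + t_ k)%R]) \is a fin_num.
  by rewrite ge0_fin_numE//; exact: le_lt_trans (ub k) Aoo.
rewrite -[X in _ --> X](fineK Afin); apply/fine_cvgP; split; first by near=> k; exact: fin.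
apply/cvgrPdist_le => e e0; near=> k.
rewrite ger0_norm ?subr_ge0 ?fine_le//.
rewrite lerBlDl -lee_fin EFinD !fineK//.
by near: k; exact: (t0 _ (lebesgue_overlap1_ge mA Aoo e0)).
Unshelve. all: end_near. Qed.

Lemma measurable_cons_preimager n (A : set 'rV[R]_n.+1) a : measurable A ->
  measurable [set x : 'rV_n | A (cons_rV (a, x))].
Proof.
move=> mA; rewrite -[X in measurable X]setTI.
exact: (measurableT_comp (@measurable_cons_rV R n) (measurable_pair1 a)).
Qed.

Lemma measurable_cons_preimagel n (A : set 'rV[R]_n.+1) (x : 'rV[R]_n) : measurable A ->
  measurable [set a : R | A (cons_rV (a, x))].
Proof.
move=> mA; rewrite -[X in measurable X]setTI.
exact: (measurableT_comp (@measurable_cons_rV R n) (measurable_pair2 x)).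
Qed.

Lemma measurable_preimage_translate n (A : set 'rV[R]_n) b : measurable A ->
  measurable [set x | A (x + b)%R].
Proof.
move=> mA; rewrite -[X in measurable X]setTI.
exact: (measurable_fun_rVD (@measurable_id _ _ setT) (@measurable_cst _ _ _ _ setT b)).
Qed.

Section sections.
Variables (n : nat) (A : set 'rV[R]_n.+1).
Hypothesis mA : measurable A.

Let mind : measurable_fun [set: 'rV_n.+1] (fun x : 'rV[R]_n.+1 => (\1_A x : R)%:E).
Proof. exact/measurable_EFinP. Qed.

Lemma lebesgue_rVS :
  lebesgue_rV R n.+1 A = \int[leb]_a lebesgue_rV R n [set x | A (cons_rV (a, x))].
Proof.
rewrite (measure_indicE (lebesgue_rV R n.+1) mA) ge0_integral_rVS//; apply: eq_integral => a _.
by rewrite (measure_indicE (lebesgue_rV R n))//; exact: measurable_cons_preimager.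
Qed.

Lemma lebesgue_rVS_swap :
  lebesgue_rV R n.+1 A = \int[lebesgue_rV R n]_x leb [set a | A (cons_rV (a, x))].
Proof.
rewrite (measure_indicE (lebesgue_rV R n.+1) mA) ge0_integral_rVS_swap//; apply: eq_integral => a _.
by rewrite (measure_indicE leb)//; exact: measurable_cons_preimagel.
Qed.

Lemma measurable_measure_sectionr :
  measurable_fun [set: R] (fun a => lebesgue_rV R n [set x | A (cons_rV (a, x))]).
Proof.
rewrite (_ : (fun _ => _) =
    fun a => \int[lebesgue_rV R n]_x (\1_A (cons_rV (a, x)))%:E).
  by apply: (@measurable_integral_sectionr _ _ (fun x => (\1_A x)%:E)).
apply/funext => a; rewrite (measure_indicE (lebesgue_rV R n))//.
exact: measurable_cons_preimager.
Qed.

Lemma measurable_measure_sectionl :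
  measurable_fun [set: 'rV_n] (fun x => leb [set a | A (cons_rV (a, x))]).
Proof.
rewrite (_ : (fun _ => _) = fun x => \int[leb]_a (\1_A (cons_rV (a, x)))%:E).
  by apply: (@measurable_integral_sectionl _ _ (fun x => (\1_A x)%:E)).
apply/funext => a; rewrite (measure_indicE leb)//.
exact: measurable_cons_preimagel.
Qed.

End sections.

Lemma lebesgue_rV_torus_cell_lty n (A : set 'rV[R]_n) : measurable A ->
  A `<=` torus_cell -> lebesgue_rV R n A < +oo.
Proof.
move=> mA AT; apply: (@le_lt_trans _ _ (lebesgue_rV R n torus_cell)).
  by apply: le_measure; rewrite ?inE//; exact: measurable_torus_cell.
have := @lebesgue_torusT R n; rewrite /lebesgue_torus /= /mrestr setTI => ->.
by rewrite ltry.
Qed.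

Lemma lebesgue_circle_cell_lty (A : set R) : measurable A ->
  A `<=` circle_cell -> leb A < +oo.
Proof.
move=> mA AT; apply: (@le_lt_trans _ _ (leb circle_cell)).
  by apply: le_measure; rewrite ?inE//; exact: measurable_itv.
by rewrite /= lebesgue_measure_itv/=; case: ifPn => // _; rewrite -EFinB ltry.
Qed.

Lemma cons_rV_shift_lift n (a t : R) (x : 'rV[R]_n) (j : 'I_n) :
  (cons_rV (a, x) + t *: delta_mx ord0 (lift ord0 j) =
   cons_rV (a, x + t *: delta_mx ord0 j))%R.
Proof.
apply/rowP => k; rewrite !mxE; case: unliftP => [l ->|->]/=.
  by rewrite !mxE/= (inj_eq lift_inj).
by rewrite mulr0 addr0.
Qed.

Lemma cons_rV_shift0 n (a t : R) (x : 'rV[R]_n) :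
  (cons_rV (a, x) + t *: delta_mx ord0 ord0 = cons_rV (a + t, x))%R.
Proof.
apply/rowP => k; rewrite !mxE; case: unliftP => [l ->|->]/=.
  by rewrite mulr0 addr0.
by rewrite mulr1.
Qed.

(** Dominated convergence over slices, the measures of the slices of A being the
    dominating function: the slices are lines when the shift is along the first
    axis, and otherwise parallel hyperplanes, to which induction applies. *)
Lemma lebesgue_overlap_cvg n (i : 'I_n) (A : set 'rV[R]_n) (t_ : R^nat) :
  measurable A -> A `<=` torus_cell -> t_ @ \oo --> (0:R)%R ->
  lebesgue_rV R n (A `&` [set x | A (x + t_ k *: delta_mx ord0 i)%R]) @[k --> \oo]
    --> lebesgue_rV R n A.
Proof.
elim: n i A => [[]//|n IH] i A mA AT t0.
pose At k := A `&` [set x | A (x + t_ k *: delta_mx ord0 i)%R].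
have mAt k : measurable (At k).
  by apply: measurableI => //; exact: measurable_preimage_translate.
have Afin := lebesgue_rV_torus_cell_lty mA AT.
have [j ij|i0] := unliftP ord0 i.
- have sec k a : [set x | At k (cons_rV (a, x))] =
      [set x | A (cons_rV (a, x))] `&`
      [set x | [set x | A (cons_rV (a, x))] (x + t_ k *: delta_mx ord0 j)%R].
    by apply/funext => x; rewrite /At /setI /mkset ij cons_rV_shift_lift.
  rewrite lebesgue_rVS//.
  under eq_fun do rewrite (lebesgue_rVS (mAt _)).
  have [] // := dominated_convergence (mu := leb) measurableT
    (f_ := fun k a => lebesgue_rV R n [set x | At k (cons_rV (a, x))])
    (f := fun a => lebesgue_rV R n [set x | A (cons_rV (a, x))])
    (g := fun a => lebesgue_rV R n [set x | A (cons_rV (a, x))]).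
  + by move=> k; exact: measurable_measure_sectionr.
  + exact: measurable_measure_sectionr.
  + apply: aeW => a _ /=; under eq_fun do rewrite sec.
    apply: IH => //; first exact: measurable_cons_preimager.
    by move=> x /AT/torus_cell_cons[].
  + apply/integrableP; split; first exact: measurable_measure_sectionr.
    under eq_integral do rewrite gee0_abs//.
    by rewrite -lebesgue_rVS.
  + apply: aeW => a k _; rewrite gee0_abs// le_measure// ?inE;
      try exact: measurable_cons_preimager.
    by move=> x [].
- have sec k x : [set a | At k (cons_rV (a, x))] =
      [set a | A (cons_rV (a, x))] `&`
      [set a | [set a | A (cons_rV (a, x))] (a + t_ k)%R].
    by apply/funext => a; rewrite /At /setI /mkset i0 cons_rV_shift0.
  rewrite lebesgue_rVS_swap//.
  under eq_fun do rewrite (lebesgue_rVS_swap (mAt _)).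
  have [] // := dominated_convergence (mu := lebesgue_rV R n) measurableT
    (f_ := fun k x => leb [set a | At k (cons_rV (a, x))])
    (f := fun x => leb [set a | A (cons_rV (a, x))])
    (g := fun x => leb [set a | A (cons_rV (a, x))]).
  + by move=> k; exact: measurable_measure_sectionl.
  + exact: measurable_measure_sectionl.
  + apply: aeW => x _ /=; under eq_fun do rewrite sec.
    have mAx := measurable_cons_preimagel x mA.
    apply: lebesgue_overlap1_cvg => //; apply: lebesgue_circle_cell_lty => //.
    by move=> a /AT/torus_cell_cons[].
  + apply/integrableP; split; first exact: measurable_measure_sectionl.
    under eq_integral do rewrite gee0_abs//.
    by rewrite -lebesgue_rVS_swap.
  + apply: aeW => x k _; rewrite gee0_abs// le_measure// ?inE;
      try exact: measurable_cons_preimagel.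
    by move=> a [].
Qed.

(** Otherwise there would be shifts t_k tending to 0 with overlap below half of the
    measure of A, against the convergence of the overlaps to that measure. *)
Lemma lebesgue_overlap_half_dir n (i : 'I_n) (A : set 'rV[R]_n) : measurable A ->
  A `<=` torus_cell -> 0 < lebesgue_rV R n A ->
  exists2 c : R, (0 < c)%R & forall t : R, (`|t| <= c)%R ->
    (2^-1)%:E * lebesgue_rV R n A <=
    lebesgue_rV R n (A `&` [set x | A (x + t *: delta_mx ord0 i)%R]).
Proof.
move=> mA AT A0; have Afin := lebesgue_rV_torus_cell_lty mA AT.
have half_lt : (2^-1)%:E * lebesgue_rV R n A < lebesgue_rV R n A.
  move: A0 Afin; case: (lebesgue_rV R n A) => //= r; rewrite !lte_fin => r0 _.
  by lra.
apply: contrapT => H.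
have /choice[t_ Ht] : forall k : nat, exists t : R, (`|t| <= k.+1%:R^-1)%R /\
    lebesgue_rV R n (A `&` [set x | A (x + t *: delta_mx ord0 i)%R]) <
    (2^-1)%:E * lebesgue_rV R n A.
  move=> k; apply: contrapT => Hk; apply: H; exists (k.+1%:R^-1)%R => // t tk.
  by rewrite leNgt; apply/negP => lt; apply: Hk; exists t.
have t0 : t_ @ \oo --> (0:R)%R.
  apply/norm_cvg0P; apply: (squeeze_cvgr _ (@cvg_cst _ _ _ _ _) (@cvg_harmonic R)).
  by near=> k; rewrite normr_ge0/= (Ht k).1.
have : lebesgue_rV R n A <= (2^-1)%:E * lebesgue_rV R n A.
  apply: cvge_to_le (lebesgue_overlap_cvg i mA AT t0) _.
  by apply: nearW => k; exact: ltW (Ht k).2.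
by rewrite leNgt half_lt.
Unshelve. all: end_near. Qed.

Lemma lebesgue_overlap_half n (A : set 'rV[R]_n) : measurable A ->
  A `<=` torus_cell -> 0 < lebesgue_rV R n A ->
  exists2 c : R, (0 < c)%R & forall (i : 'I_n) (t : R), (`|t| <= c)%R ->
    (2^-1)%:E * lebesgue_rV R n A <=
    lebesgue_rV R n (A `&` [set x | A (x + t *: delta_mx ord0 i)%R]).
Proof.
move=> mA AT A0.
have /choice[c_ Hc] : forall i : 'I_n, exists c : R, (0 < c)%R /\ forall t : R, (`|t| <= c)%R ->
    (2^-1)%:E * lebesgue_rV R n A <=
    lebesgue_rV R n (A `&` [set x | A (x + t *: delta_mx ord0 i)%R]).
  by move=> i; have [c] := lebesgue_overlap_half_dir i mA AT A0; exists c.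
exists (\big[Num.min/1%R]_i c_ i); first by apply: lt_bigmin => // i _; case: (Hc i).
by move=> i t tc; apply: (Hc i).2; apply: (le_trans tc); exact: bigmin_le.
Qed.

End overlap.

(** * Lipschitz images of null sets *)

Section lipschitz_null.
Context (R : realType).
Notation leb := (@lebesgue_measure R).
Local Open Scope ereal_scope.

(** Cover N by half-open intervals of total length below e.  The image of an
    interval of length l lies in the interval of length l centred at the image of
    its midpoint, so S is covered by intervals of total length below e. *)
Lemma lipschitz_image_null (phi : R -> R) (N S : set R) :
  (forall x y, `|phi x - phi y| <= `|x - y|)%R ->
  measurable S -> S `<=` phi @` N -> leb N = 0 -> leb S = 0.
Proof.
move=> lip mS SN N0; apply/eqP; rewrite eq_le measure_ge0 andbT.
apply/lee_addgt0Pr => e e0; rewrite add0e.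
have /ereal_inf_lt[z [/= M covM sM ze]] : leb N < e%:E by rewrite N0 lte_fin.
have /choice[I HI] : forall k, exists I : set R,
    [/\ measurable I, phi @` (M k) `<=` I & leb I <= wlength idfun (M k)].
  move=> k; have /ocitvP[->|[[a b /= ab ->]]] : ocitv (M k) by case: covM => /(_ k).
    by exists set0; rewrite image_set0 measure0; split.
  pose m := (phi ((a + b) / 2))%R; pose r := ((b - a) / 2)%R.
  exists `[(m - r)%R, (m + r)%R]%classic; split; first exact: measurable_itv.
    move=> _ [x /= /[!in_itv]/= /andP[ax xb] <-].
    rewrite -ler_distlC; apply: (le_trans (lip _ _)).
    by rewrite ler_norml /r; apply/andP; split; lra.
  rewrite lebesgue_measure_itv/= wlength_itv/= !lte_fin ab.
  case: ifPn => // _; rewrite ?lee_fin /r ?subr_ge0 ?(ltW ab)//.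
  by lra.
apply: (@le_trans _ _ (\sum_(k <oo) leb (I k))).
  apply: measure_sigma_subadditive => // [k|]; first by have [] := HI k.
  move=> x /SN[y Ny <-]; have [_ /(_ _ Ny)[k _ Mky]] := covM.
  by exists k => //; have [_ + _] := HI k; apply; exists y.
rewrite (le_trans _ (ltW ze))// -sM lee_nneseries// => k _.
by have [] := HI k.
Qed.

Lemma sqrt_sumsq_lipschitz (c x y : R) : (0 <= c)%R ->
  (`|Num.sqrt (x ^+ 2 + c) - Num.sqrt (y ^+ 2 + c)| <= `|x - y|)%R.
Proof.
move=> c0; set s := Num.sqrt _; set t := Num.sqrt _.
have s0 : (0 <= s)%R by exact: sqrtr_ge0.
have t0 : (0 <= t)%R by exact: sqrtr_ge0.
have sE : (s ^+ 2 = x ^+ 2 + c)%R by rewrite sqr_sqrtr// addr_ge0// sqr_ge0.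
have tE : (t ^+ 2 = y ^+ 2 + c)%R by rewrite sqr_sqrtr// addr_ge0// sqr_ge0.
have st : (x * y + c <= s * t)%R.
  apply: le_trans (ler_norm _) _.
  rewrite -(@ler_pXn2r _ 2)// ?nnegrE// ?mulr_ge0// real_normK ?num_real//.
  rewrite exprMn sE tE; have := mulr_ge0 c0 (sqr_ge0 (x - y)); nra.
rewrite -(@ler_pXn2r _ 2)// ?nnegrE// !real_normK ?num_real//.
by rewrite !sqrrB sE tE; lra.
Qed.

End lipschitz_null.

(** * A set of positive measure on which the kernel is bounded below *)

Section enorm_theory.
Context (R : realType).
Notation leb := (@lebesgue_measure R).

Lemma dotrr_ge0 n (x : 'rV[R]_n) : 0 <= dotr x x.
Proof. by apply: sumr_ge0 => i _; rewrite -expr2 sqr_ge0. Qed.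

Lemma enorm_ge0 n (x : 'rV[R]_n) : 0 <= enorm x.
Proof. exact: sqrtr_ge0. Qed.

Lemma enormZ n (k : R) (x : 'rV[R]_n) : 0 <= k -> enorm (k *: x) = k * enorm x.
Proof.
move=> k0; rewrite /enorm (_ : dotr _ _ = k ^+ 2 * dotr x x).
  by rewrite sqrtrM ?sqr_ge0// sqrtr_sqr ger0_norm.
by rewrite /dotr mulr_sumr; apply: eq_bigr => i _; rewrite !mxE; ring.
Qed.

Lemma normr_coord_le_enorm n (x : 'rV[R]_n) i : `|x ord0 i| <= enorm x.
Proof.
rewrite -sqrtr_sqr ler_sqrt ?dotrr_ge0// /dotr (bigD1 i)//= -expr2 lerDl.
by apply: sumr_ge0 => j _; rewrite -expr2 sqr_ge0.
Qed.

Lemma enorm_cons n a (x : 'rV[R]_n) :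
  enorm (cons_rV (a, x)) = Num.sqrt (a ^+ 2 + dotr x x).
Proof.
rewrite /enorm /dotr big_ord_recl; congr (Num.sqrt (_ + _)).
  by rewrite !mxE unlift_none -expr2.
by apply: eq_bigr => i _; rewrite !mxE liftK.
Qed.

Lemma measurable_enorm n : measurable_fun [set: 'rV[R]_n] (@enorm R n).
Proof.
rewrite (_ : @enorm R n = @Num.sqrt R \o (fun x => dotr x x))//.
apply: measurableT_comp.
  by apply: continuous_measurable_fun; exact: sqrt_continuous.
rewrite /dotr; apply: measurable_sum => i.
by apply: measurable_funM; exact: measurable_coord_rV.
Qed.

Lemma dotr_cube_le n (x : 'rV[R]_n) (b : R) : (forall i, `|x ord0 i| <= b) ->
  dotr x x <= n%:R * b ^+ 2.
Proof.
move=> xb; apply: (@le_trans _ _ (\sum_(i < n) b ^+ 2)).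
  apply: ler_sum => i _; rewrite -expr2 -[leLHS]real_normK ?num_real//.
  by rewrite ler_pXn2r ?nnegrE// (le_trans _ (xb i)).
by rewrite sumr_const card_ord mulr_natl.
Qed.

Local Open Scope ereal_scope.

Lemma lebesgue_rV_small_cube n (k : R) : (0 < k)%R ->
  0 < lebesgue_rV R n [set x | torus_cell (k *: x)].
Proof.
move=> k0; have mT := @measurable_torus_cell R n.
have mTk : measurable [set x : 'rV[R]_n | torus_cell (k *: x)].
  rewrite -[X in measurable X]setTI.
  by apply: (measurable_fun_rVZ (@measurable_cst _ _ _ _ setT k) (@measurable_id _ _ setT)).
have : (k ^+ n)%:E * lebesgue_rV R n [set x | torus_cell (k *: x)] =
    lebesgue_rV R n torus_cell.
  rewrite (measure_indicE (lebesgue_rV R n) mTk) (measure_indicE (lebesgue_rV R n) mT).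
  rewrite -[RHS](ge0_integral_rV_affine 0 k0)//; last exact/measurable_EFinP.
  by congr (_ * _); apply: eq_integral => x _; rewrite addr0.
have -> : lebesgue_rV R n torus_cell = ((2 * pi) ^+ n)%:E.
  by rewrite -lebesgue_torusT /lebesgue_torus /= /mrestr setTI.
move=> E; rewrite lt_neqAle measure_ge0 andbT; apply/eqP => E0.
move: E; rewrite -E0 mule0 => -[] /esym/eqP; rewrite gt_eqF//.
by rewrite exprn_gt0// mulr_gt0// pi_gt0.
Qed.

(** This takes the place of integration in polar coordinates.  By Fubini almost
    every line parallel to the first axis meets the radial set in a null set; some
    such line passes at distance at most e from the origin.  Along it the norm is the
    1-Lipschitz function a |-> sqrt (a^2 + dotr x x), and every radius beyond e is
    attained.  So the part of S beyond e is null, for all e > 0. *)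
Lemma radial_null_set n (S : set R) : measurable S -> S `<=` `]0%R, +oo[ ->
  lebesgue_rV R n.+1 [set x | S (enorm x)] = 0 -> leb S = 0.
Proof.
move=> mS S0; set B := [set x | _].
have mB : measurable B.
  by rewrite -[B]setTI; exact: measurable_enorm.
rewrite lebesgue_rVS_swap// => B0.
have ae0 : {ae lebesgue_rV R n, forall x, leb [set a | B (cons_rV (a, x))] = 0}.
  have := (ae_eq_integral_abs (lebesgue_rV R n) measurableT (measurable_measure_sectionl mB)).1.
  under eq_integral do rewrite gee0_abs//.
  by move=> /(_ B0); apply: filterS => x; exact.
have Seps (e : R) : (0 < e)%R -> leb (S `&` `]e, +oo[) = 0.
  move=> e0.
  (* The cube of half-side pi / k = e / (n + 1) lies in the ball of radius e. *)
  pose k := (n.+1%:R * pi / e)%R.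
  have k0 : (0 < k)%R by rewrite divr_gt0// mulr_gt0// pi_gt0.
  have [x xk x0] : exists2 x, torus_cell (k *: x) & leb [set a | B (cons_rV (a, x))] = 0.
    apply: contrapT => H.
    have [N [mN N0 HN]] := ae0.
    have := lebesgue_rV_small_cube n k0; rewrite ltNge => /negP; apply.
    rewrite -N0; apply: le_measure; rewrite ?inE//.
      rewrite -[X in measurable X]setTI.
      by apply: (measurable_fun_rVZ (@measurable_cst _ _ _ _ setT k)
        (@measurable_id _ _ setT) _ measurable_torus_cell).
    by move=> x Tx; apply: HN => /= x0; apply: H; exists x.
  have xc : (dotr x x <= e ^+ 2)%R.
    apply: (@le_trans _ _ (n%:R * (pi / k) ^+ 2)%R).
      apply: dotr_cube_le => i; have := xk i; rewrite mxE => /andP[h1 h2].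
      by rewrite ler_pdivlMr// mulrC -[k in leLHS]gtr0_norm// -normrM ler_norml h1 ltW.
    have -> : (pi / k = e / n.+1%:R)%R.
      have H (p N : R) : (0 < p -> 0 < N -> p / (N * p / e) = e / N)%R.
        by move=> p0 N0; field; rewrite !gt_eqF.
      by apply: H => //; exact: pi_gt0.
    rewrite expr_div_n mulrA ler_pdivrMr ?exprn_gt0// mulrC ler_wpM2l ?sqr_ge0//.
    by rewrite -natrX ler_nat (leq_trans (leqnSn n))// leq_pmulr.
  apply: (lipschitz_image_null (phi := fun a => Num.sqrt (a ^+ 2 + dotr x x)%R) _ _ _ x0).
  + by move=> a b; apply: sqrt_sumsq_lipschitz; exact: dotrr_ge0.
  + by apply: measurableI.
  + move=> s /= [Ss]; rewrite in_itv/= andbT => es.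
    have s2 : (Num.sqrt (Num.sqrt (s ^+ 2 - dotr x x) ^+ 2 + dotr x x) = s)%R.
      have h : (0 <= s ^+ 2 - dotr x x)%R.
        by rewrite subr_ge0 (le_trans xc)// ler_pXn2r ?nnegrE ?ltW// (lt_trans e0).
      by rewrite sqr_sqrtr// subrK sqrtr_sqr gtr0_norm// (lt_trans e0).
    exists (Num.sqrt (s ^+ 2 - dotr x x)%R) => //=.
    by rewrite /B/= enorm_cons s2.
have -> : S = \bigcup_k (S `&` `]k.+1%:R^-1%R, +oo[).
  apply/seteqP; split => [s Ss|s [k _ []]//].
  have := S0 _ Ss; rewrite /= in_itv/= andbT => s0.
  have [k _ /(_ k (leqnn k)) ks] := near_infty_natSinv_lt (PosNum s0).
  by exists k => //; split => //=; rewrite in_itv/= andbT.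
apply/eqP; rewrite eq_le measure_ge0 andbT.
apply: (le_trans (measure_sigma_subadditive leb _ _ (@subset_refl _ _))) => //.
- by move=> k; apply: measurableI.
- by apply: bigcup_measurable => k _; apply: measurableI.
- by rewrite eseries0// => k _ _; exact: Seps.
Qed.

(** The normalisation prevents the profile at scale 1 from vanishing almost
    everywhere on the half-line, so J_1 is positive on a radial set that is not
    null, and some superlevel set of J_1 has positive measure.  The support of the
    profile places that set inside the torus cell. *)
Lemma admissible_kernel_lower_bound n (rho : R -> R -> R) : (0 < n)%N ->
  admissible_kernel n rho ->
  exists c : R, exists A : set 'rV[R]_n,
    [/\ (0 < c)%R, measurable A, A `<=` torus_cell, 0 < lebesgue_rV R n A &
        forall z, A z -> (c <= J rho 1%R z)%R].
Proof.
case: n => // n _ rhoK.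
have mJ : measurable_fun [set: 'rV_n.+1] (@J R n.+1 rho 1%R).
  by have [/[!inE]/andP[/[!inE]/= mJ _] _] := J_W11 rhoK ltr01.
have mrho : measurable_fun [set: R] (rho 1%R).
  by have := rho_L1 rhoK ltr01 => /[!inE]/andP[/[!inE]/= mr _].
have rho0 r : (0 <= rho 1%R r)%R by exact: (rho_ge0 rhoK).
pose S := [set r | 0 < r /\ 0 < rho 1%R r]%R.
have mS : measurable S.
  rewrite (_ : S = `]0%R, +oo[ `&` (rho 1%R @^-1` `]0%R, +oo[)); last first.
    by apply/seteqP; split => r/=; rewrite !in_itv/= !andbT.
  apply: measurableI; first exact: measurable_itv.
  by rewrite -[X in measurable X]setTI; apply: mrho => //; exact: measurable_itv.
pose A k := [set z : 'rV[R]_n.+1 | k.+1%:R^-1 <= J rho 1%R z]%R.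
have mA k : measurable (A k).
  rewrite (_ : A k = J rho 1%R @^-1` `[k.+1%:R^-1%R, +oo[); last first.
    by apply/seteqP; split => r/=; rewrite !in_itv/= !andbT.
  by rewrite -[X in measurable X]setTI; apply: mJ => //; exact: measurable_itv.
have [k Ak] : exists k, 0 < lebesgue_rV R n.+1 (A k).
  apply: contrapT => H.
  have A0 k : lebesgue_rV R n.+1 (A k) = 0.
    apply/eqP; rewrite eq_le measure_ge0 andbT leNgt; apply/negP => h; apply: H.
    by exists k.
  have S0 : leb S = 0.
    apply: (@radial_null_set n S mS) => [r [? _]|]; first by rewrite /= in_itv/= andbT.
    have SA : [set x : 'rV[R]_n.+1 | S (enorm x)] = \bigcup_k A k.
      apply/seteqP; split => x /=.
        move=> [x0 rx]; have Jx : (0 < J rho 1 x)%R by rewrite divr_gt0// exprn_gt0.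
        have [k _ /(_ k (leqnn k)) ks] := near_infty_natSinv_lt (PosNum Jx).
        by exists k => //; exact: ltW.
      move=> [k _ /(lt_le_trans _) Jx]; have {}Jx : (0 < J rho 1 x)%R.
        by apply: Jx; rewrite invr_gt0.
      (* At the origin J_1 takes the value 0, by the convention 1 / 0 = 0. *)
      split; rewrite lt_neqAle ?enorm_ge0 ?rho0 andbT eq_sym; apply: contraTneq Jx;
        by rewrite /J => ->; rewrite ?mul0r ?expr0n/= ?invr0 ?mulr0 ltxx.
    apply/eqP; rewrite SA eq_le measure_ge0 andbT.
    apply: (le_trans (measure_sigma_subadditive (lebesgue_rV R n.+1) _ _ (@subset_refl _ _))) => //.
      exact: bigcup_measurable.
    by rewrite eseries0// => k _ _; exact: A0.
  have := rho_normalized rhoK ltr01.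
  rewrite [X in _ * X](_ : _ = 0) ?mule0; first by move=> [] /eqP; rewrite eq_sym pnatr_eq0.
  rewrite (ae_eq_integral (cst 0)) ?integral0//.
  - apply/measurable_EFinP/measurable_funM; first exact: measurable_funTS.
    exact: measurable_funX.
  - exists (S `|` [set 0%R]); split.
    + by apply: measurableU => //; exact: measurable_set1.
    + by rewrite measureU0 //; exact: lebesgue_measure_set1.
    + move=> r /= /not_implyP[]; rewrite in_itv/= andbT => r0 /eqP f0.
      have [->|rn0] := eqVneq r 0%R; [by right|left].
      split; first by rewrite lt_neqAle eq_sym rn0.
      rewrite lt_neqAle rho0 andbT eq_sym; apply/eqP => rr.
      by move: f0; rewrite rr mul0r eqxx.
exists (k.+1%:R^-1)%R, (A k); split => // z Az.
have := lt_le_trans _ Az => /(_ 0%R (ltac:(by rewrite invr_gt0))) Jz.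
have rz : rho 1%R (enorm z) != 0%R.
  by apply: contraTneq Jz; rewrite /J => ->; rewrite mul0r ltxx.
have : closure [set r | rho 1%R r != 0%R] (enorm z) by exact: subset_closure.
move=> /(rho1_support rhoK).2; rewrite /= in_itv/= => /andP[_ zpi] i.
have := le_lt_trans (normr_coord_le_enorm z i) zpi.
by rewrite ltr_norml => /andP[/ltW -> ->].
Qed.

End enorm_theory.

(** * Translation defects and the energy *)

Lemma sqr_sum_le (R : realFieldType) k (a : 'I_k -> R) :
  (\sum_j a j) ^+ 2 <= k%:R * \sum_j a j ^+ 2.
Proof.
elim: k a => [|k IH] a; first by rewrite !big_ord0 expr0n mul0r.
rewrite !big_ord_recr/=; set S := \sum_(i < k) a _; set Q := \sum_(i < k) _ ^+ 2.
set b := a ord_max; have SQ : S ^+ 2 <= k%:R * Q by exact: IH.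
have SbQ : 2 * S * b <= Q + k%:R * b ^+ 2.
  rewrite /S mulr_sumr mulr_suml.
  have -> : k%:R * b ^+ 2 = \sum_(i < k) b ^+ 2 by rewrite sumr_const card_ord mulr_natl.
  rewrite -big_split; apply: ler_sum => i _ /=.
  by rewrite -subr_ge0 (_ : _ - _ = (a (widen_ord (leqnSn k) i) - b) ^+ 2) ?sqr_ge0//; ring.
rewrite -natr1; lra.
Qed.

Section translation_defect.
Context (R : realType) (n : nat).
Notation T := (@torus R n).
Implicit Types (u : 'rV[R]_n -> R) (h x : 'rV[R]_n).
Local Open Scope ereal_scope.

Lemma ge0_torus_translate h (f : 'rV[R]_n -> \bar R) :
  measurable_fun [set: 'rV_n] f -> (forall x, 0 <= f x) ->
  (forall i x, f (x + (2 * pi) *: delta_mx ord0 i)%R = f x) ->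
  \int[T]_x f (x + h)%R = \int[T]_x f x.
Proof. exact: ge0_integral_torus_translate. Qed.

Definition translation_defect u h : \bar R :=
  \int[T]_x ((u (x + h) - u x) ^+ 2)%:E.

Section measurability.
Variable u : 'rV[R]_n -> R.
Hypothesis mu : measurable_fun [set: 'rV_n] u.

Lemma measurable_diff d (S : measurableType d) (f g : S -> 'rV[R]_n) :
  measurable_fun [set: S] f -> measurable_fun [set: S] g ->
  measurable_fun [set: S] (fun s => ((u (f s) - u (g s)) ^+ 2)%:E).
Proof.
move=> mf mg; apply/measurable_EFinP; apply: measurable_funX.
by apply: measurable_funB; apply: (measurableT_comp mu).
Qed.

Lemma measurable_diff_translate h :
  measurable_fun [set: 'rV_n] (fun x => ((u (x + h) - u x) ^+ 2)%:E).
Proof. by apply: measurable_diff => //; exact: measurable_fun_rVD. Qed.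

Lemma measurable_translation_defect :
  measurable_fun [set: 'rV_n] (translation_defect u).
Proof.
apply: (@measurable_fun_fubini_tonelli_G _ _ _ _ _ T
    (fun p => ((u (p.1 + p.2) - u p.1) ^+ 2)%:E)).
  by apply: measurable_diff => //; exact: measurable_fun_rVD.
by move=> p; rewrite lee_fin sqr_ge0.
Qed.

End measurability.

Lemma translation_defect_ge0 u h : 0 <= translation_defect u h.
Proof. by apply: integral_ge0 => x _; rewrite lee_fin sqr_ge0. Qed.

Section triangle.
Variable u : 'rV[R]_n -> R.
Hypotheses (pu : Defs.periodic u) (mu : measurable_fun [set: 'rV_n] u).

Lemma translation_defect_translate h z :
  \int[T]_x ((u (x + z + h) - u (x + z)) ^+ 2)%:E = translation_defect u h.
Proof.
apply: (@ge0_torus_translate z (fun x => ((u (x + h) - u x) ^+ 2)%:E)).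
- exact: measurable_diff_translate.
- by move=> x; rewrite lee_fin sqr_ge0.
- by move=> i x; rewrite addrAC !pu.
Qed.

(** (a + b)^2 <= 2 a^2 + 2 b^2 for the path from x + z to x + z + h through x. *)
Lemma translation_defect_sub h z : translation_defect u h <=
  2%:E * translation_defect u (z + h)%R + 2%:E * translation_defect u z.
Proof.
rewrite -(translation_defect_translate h z).
rewrite -!ge0_integralZl//; try exact: measurable_diff_translate;
  try by move=> *; rewrite lee_fin sqr_ge0.
rewrite -ge0_integralD//; last 4 first.
- by move=> x _; rewrite -EFinM lee_fin mulr_ge0// sqr_ge0.
- by apply: measurable_funeM; exact: measurable_diff_translate.
- by move=> x _; rewrite -EFinM lee_fin mulr_ge0// sqr_ge0.
- by apply: measurable_funeM; exact: measurable_diff_translate.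
apply: ge0_le_integral => //.
- by move=> x _; rewrite lee_fin sqr_ge0.
- by apply: measurable_diff => //; do ?apply: measurable_fun_rVD.
- by apply: emeasurable_funD; apply: measurable_funeM; exact: measurable_diff_translate.
move=> x _; rewrite -!EFinM -EFinD lee_fin addrA.
by have := sqr_ge0 (u (x + z + h) - u x + (u (x + z) - u x)); nra.
Qed.

(** Telescope u (x + k h) - u x into k steps and apply Cauchy-Schwarz; each step
    contributes the same integral, by translation invariance. *)
Lemma translation_defect_mulrn h k :
  translation_defect u (h *+ k) <= (k%:R ^+ 2)%:E * translation_defect u h.
Proof.
case: k => [|k].
  rewrite mulr0n expr0n mul0e /translation_defect.
  by rewrite integral0_eq// => x _; rewrite addr0 subrr expr0n.
apply: (@le_trans _ _ (\int[T]_x \sum_(j < k.+1) (k.+1%:R)%:E *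
    ((u (x + h *+ j + h) - u (x + h *+ j)) ^+ 2)%:E)).
  apply: ge0_le_integral => //.
  - by move=> x _; rewrite lee_fin sqr_ge0.
  - exact: measurable_diff_translate.
  - apply: emeasurable_sum => j; apply: measurable_funeM.
    by apply: measurable_diff => //; do ?apply: measurable_fun_rVD.
  move=> x _; under eq_bigr do rewrite -EFinM.
  rewrite sumEFin lee_fin -mulr_sumr.
  have -> : (u (x + h *+ k.+1) - u x =
      \sum_(j < k.+1) (u (x + h *+ j + h) - u (x + h *+ j)))%R.
    under eq_bigr do rewrite -addrA -mulrSr.
    rewrite -(big_mkord xpredT (fun j => u (x + h *+ j.+1) - u (x + h *+ j))%R).
    by rewrite (@telescope_sumr _ 0 k.+1 (fun j => u (x + h *+ j)))// mulr0n addr0.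
  exact: sqr_sum_le.
rewrite ge0_integral_sum//; last 2 first.
- move=> j; apply: measurable_funeM.
  by apply: measurable_diff => //; do ?apply: measurable_fun_rVD.
- by move=> j x _; rewrite -EFinM lee_fin mulr_ge0// sqr_ge0.
under eq_bigr => j _.
  rewrite ge0_integralZl//; last 2 first.
  - by apply: measurable_diff => //; do ?apply: measurable_fun_rVD.
  - by move=> x _; rewrite lee_fin sqr_ge0.
  rewrite translation_defect_translate; over.
have sum_const m (X : \bar R) : 0 <= X -> \sum_(j < m) X = (m%:R)%:E * X.
  move=> X0; elim: m => [|m IH]; first by rewrite big_ord0 mul0e.
  by rewrite big_ord_recr/= IH -natr1 EFinD ge0_muleDl ?mul1e.
rewrite (sum_const _ (k.+1%:R%:E * _))/=.
  by rewrite muleA -EFinM -expr2.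
by rewrite mule_ge0// translation_defect_ge0.
Qed.

End triangle.

Section energy_bound.
Variable rho : R -> R -> R.
Hypothesis n_gt0 : (0 < n)%N.
Hypothesis rhoK : admissible_kernel n rho.

Lemma measurable_kernel (eta : R) : (0 < eta)%R -> measurable_fun [set: 'rV_n] (@J R n rho eta).
Proof. by move=> eta0; have [/[!inE]/andP[/[!inE]/= mJ _] _] := J_W11 rhoK eta0. Qed.

Lemma kernel_ge0 (eta : R) (x : 'rV[R]_n) : (0 < eta)%R -> (0 <= J rho eta x)%R.
Proof.
by move=> eta0; rewrite divr_ge0// ?exprn_ge0 ?enorm_ge0//; exact: (rho_ge0 rhoK).
Qed.

Lemma kernel_scaling (eta : R) (w : 'rV[R]_n) : (0 < eta)%R ->
  J rho eta (eta *: w) = (eta ^- n.+2 * J rho 1 w)%R.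
Proof.
move=> eta0; rewrite /J (rho_scaling rhoK)// enormZ ?ltW//.
have -> : (eta * enorm w / eta = enorm w)%R by rewrite mulrC mulKf ?gt_eqF.
have -> : (eta ^- n.+2 = eta ^- n * eta ^- 2)%R by rewrite -invfM -exprD addn2.
have -> : ((eta * enorm w) ^- 2 = eta ^- 2 * enorm w ^- 2)%R by rewrite -invfM -exprMn.
by rewrite -!mulrA [(rho _ _ * (_ * _))%R]mulrCA.
Qed.

Lemma measurable_torus_repr : measurable_fun [set: 'rV_n] (@torus_repr R n).
Proof.
apply: measurable_fun_rVP => i.
rewrite (_ : _ \o _ = (fun t : R => (t - 2 * pi * (Num.floor ((t + pi) / (2 * pi)))%:~R)%R)
    \o coord_rV i); last by apply/funext => x; rewrite /= /coord_rV mxE.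
apply: measurableT_comp; last exact: measurable_coord_rV.
apply: measurable_funB => //; apply: measurable_funM => //.
apply: nondecreasing_measurable => // s t st.
by rewrite ler_int le_floor// ler_pM2r ?lerD2r// invr_gt0 mulr_gt0// pi_gt0.
Qed.

Lemma torus_repr_id (x : 'rV[R]_n) : torus_cell x -> torus_repr x = x.
Proof.
move=> Tx; apply/rowP => i; rewrite mxE (_ : Num.floor _ = 0%R) ?mulr0 ?subr0//.
have /andP[x1 x2] := Tx i; apply: floor_def; rewrite add0r mulr0z mulr1z.
have pi2 : (0 < 2 * pi :> R)%R by rewrite mulr_gt0// pi_gt0.
by rewrite ltr_pdivrMr // divr_ge0 ?(ltW pi2)//=; lra.
Qed.

Lemma torus_repr_periodic i (x : 'rV[R]_n) :
  torus_repr (x + (2 * pi) *: delta_mx ord0 i)%R = torus_repr x.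
Proof.
have pi2 : (2 * pi != 0 :> R)%R by rewrite gt_eqF// mulr_gt0// pi_gt0.
apply/rowP => k; rewrite !mxE eqxx /=; case: (k == i); last by rewrite mulr0 addr0.
rewrite mulr1.
have -> : ((x ord0 k + 2 * pi + pi) / (2 * pi) = (x ord0 k + pi) / (2 * pi) + 1)%R.
  by rewrite addrAC mulrDl divff.
by rewrite floorDrz ?num_real// floor1 intrD; ring.
Qed.

(** Substitute x = y + z and integrate in y first. *)
Lemma energyE (eta : R) u : (0 < eta)%R -> Defs.periodic u -> measurable_fun [set: 'rV_n] u ->
  energy rho eta u = (4^-1)%:E *
    \int[T]_z ((periodic_extension (J rho eta) z)%:E * translation_defect u z).
Proof.
move=> eta0 pu mu; congr (_ * _).
have mP : measurable_fun [set: 'rV_n] (periodic_extension (@J R n rho eta)).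
  by apply: measurableT_comp; [exact: measurable_kernel|exact: measurable_torus_repr].
have P0 x : (0 <= periodic_extension (@J R n rho eta) x)%R by exact: kernel_ge0.
transitivity (\int[T]_x \int[T]_y
    (periodic_extension (J rho eta) (x - y) * (u x - u y) ^+ 2)%:E).
  by apply: eq_integral => x _; apply: eq_integral => y _; rewrite real_normK ?num_real.
rewrite (@fubini_tonelli _ _ _ _ _ T T (fun p =>
    (periodic_extension (J rho eta) (p.1 - p.2) * (u p.1 - u p.2) ^+ 2)%:E))/=; last 2 first.
- apply/measurable_EFinP; apply: measurable_funM.
    apply: measurableT_comp mP _; apply: measurable_fun_rVD => //.
    exact: measurable_fun_rVN.
  by apply: measurable_funX; apply: measurable_funB; apply: measurableT_comp.
- by move=> p; rewrite lee_fin mulr_ge0// sqr_ge0.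
transitivity (\int[T]_y \int[T]_z
    (periodic_extension (J rho eta) z * (u (y + z) - u y) ^+ 2)%:E).
  apply: eq_integral => y _.
  rewrite -[LHS](@ge0_torus_translate y); last 3 first.
  - apply/measurable_EFinP; apply: measurable_funM.
      by apply: measurableT_comp mP _; exact: measurable_fun_rVD.
    by apply: measurable_funX; apply: measurable_funB => //; apply: measurableT_comp.
  - by move=> z; rewrite lee_fin mulr_ge0// sqr_ge0.
  - by move=> i z; rewrite pu addrAC /periodic_extension /= torus_repr_periodic.
  by apply: eq_integral => z _; rewrite addrK (addrC y).
rewrite (@fubini_tonelli _ _ _ _ _ T T (fun p =>
    (periodic_extension (J rho eta) p.2 * (u (p.1 + p.2) - u p.1) ^+ 2)%:E))/=; last 2 first.
- apply/measurable_EFinP; apply: measurable_funM; first exact: measurableT_comp mP _.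
  apply: measurable_funX; apply: measurable_funB; apply: measurableT_comp => //.
  exact: measurable_fun_rVD.
- by move=> p; rewrite lee_fin mulr_ge0// sqr_ge0.
apply: eq_integral => z _; under eq_integral do rewrite EFinM.
rewrite ge0_integralZl//; first exact: measurable_diff_translate.
  by move=> x _; rewrite lee_fin sqr_ge0.
exact: P0.
Qed.

(** On A the kernel satisfies J_eta (eta w) = eta^(-n-2) J_1 w >= c eta^(-n-2), and
    eta A still lies in the torus cell, where J_eta is its own periodic extension.
    The substitution z = eta w costs eta^n, which leaves eta^2 / c; the factor 4
    undoes the 1/4 in the energy. *)
Lemma integral_dilated_defect_le (c eta : R) (A : set 'rV[R]_n) u : (0 < c)%R ->
  (0 < eta <= 1)%R -> Defs.periodic u -> measurable_fun [set: 'rV_n] u ->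
  measurable A -> A `<=` torus_cell -> (forall z, A z -> (c <= J rho 1 z)%R) ->
  \int[lebesgue_rV R n]_w ((\1_A w)%:E * translation_defect u (eta *: w)%R) <=
  (4 * eta ^+ 2 / c)%:E * energy rho eta u.
Proof.
move=> c0 /andP[eta0 eta1] pu mu mA AT AJ.
have mD := measurable_translation_defect mu.
have mind : measurable_fun [set: 'rV_n] (fun z : 'rV[R]_n => (\1_A (eta^-1 *: z))%:E : \bar R).
  apply/measurable_EFinP; apply: (measurableT_comp (@measurable_indic _ _ _ setT _ mA)).
  exact: measurable_fun_rVZ.
pose f z : \bar R := (\1_A (eta^-1 *: z))%:E * translation_defect u z.
have f0 z : 0 <= f z by rewrite mule_ge0 ?translation_defect_ge0.
have mf : measurable_fun [set: 'rV_n] f by exact: emeasurable_funM.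
pose F z := (eta ^+ n.+2 / c)%:E *
  ((periodic_extension (@J R n rho eta) z)%:E * translation_defect u z).
have mPD : measurable_fun [set: 'rV_n] (fun z =>
    (periodic_extension (@J R n rho eta) z)%:E * translation_defect u z).
  apply: emeasurable_funM => //; apply/measurable_EFinP.
  by apply: measurableT_comp; [exact: measurable_kernel|exact: measurable_torus_repr].
have PD0 z : 0 <= (periodic_extension (@J R n rho eta) z)%:E * translation_defect u z.
  by rewrite mule_ge0 ?translation_defect_ge0// lee_fin; exact: kernel_ge0.
have fF : \int[lebesgue_rV R n]_z f z <= \int[T]_z F z.
  rewrite [leRHS]ge0_integral_torusE; last 2 first.
  - exact: measurable_funeM.
  - by move=> z; rewrite mule_ge0// lee_fin divr_ge0 ?exprn_ge0 ?ltW.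
  rewrite [leRHS]integral_mkcond; apply: ge0_le_integral => //.
    apply/(measurable_restrictT _ _).1; first exact: measurable_torus_cell.
    by apply: measurable_funTS; exact: measurable_funeM.
  move=> z _; rewrite /f indicE; have [/set_mem Az|_] := boolP (_ \in A); last first.
    by rewrite mul0e erestrict_ge0// => x _; rewrite mule_ge0// lee_fin divr_ge0 ?exprn_ge0 ?ltW.
  have zE : z = eta *: (eta^-1 *: z) by rewrite scalerA divff ?gt_eqF// scale1r.
  have Tz : torus_cell z.
    move=> i; have /andP[h1 h2] := AT _ Az i; rewrite zE mxE.
    move: h1 h2; set a := (_ ord0 i) => h1 h2; have p0 := pi_gt0 R.
    by apply/andP; split; nra.
  rewrite mul1e patchE mem_set// /F muleA -EFinM -[leLHS]mul1e.
  apply: lee_wpmul2r; first exact: translation_defect_ge0.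
  rewrite lee_fin /periodic_extension /= torus_repr_id// [in leRHS]zE kernel_scaling//.
  have H (X j : R) : (0 < X)%R -> (X / c * (X^-1 * j) = j / c)%R.
    by move=> X0; field; rewrite !gt_eqF.
  by rewrite H ?exprn_gt0// ler_pdivlMr// mul1r; exact: AJ.
have : (eta ^+ n)%:E * \int[lebesgue_rV R n]_w f (eta *: w + 0)%R <= \int[T]_z F z.
  by rewrite ge0_integral_rV_affine.
rewrite ge0_integralZl//; last by rewrite lee_fin divr_ge0 ?exprn_ge0 ?ltW.
move=> H; rewrite energyE// muleA -EFinM.
have -> : (4 * eta ^+ 2 / c * 4^-1 = eta ^- n * (eta ^+ n.+2 / c))%R.
  have -> : (eta ^+ n.+2 = eta ^+ n * eta ^+ 2)%R by rewrite -exprD addn2.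
  have H' (X e : R) : (0 < X)%R -> (4 * e / c / 4 = X^-1 * (X * e / c))%R.
    by move=> X0; field; rewrite !gt_eqF.
  by rewrite -H'// exprn_gt0.
rewrite EFinM -muleA; apply: le_trans (lee_wpmul2l _ H); last first.
  by rewrite lee_fin invr_ge0 exprn_ge0// ltW.
rewrite muleA -EFinM mulVf ?gt_eqF ?exprn_gt0// mul1e.
rewrite le_eqVlt; apply/orP; left; apply/eqP; apply: eq_integral => w _.
by rewrite /f addr0 scalerA mulVf ?gt_eqF// scale1r.
Qed.

(** Let m be the measure of A.  For the points w of the overlap B of A with its
    translate by -h, both w and w + h lie in A, so integrating over B the bound
    D (eta h) <= 2 D (eta (w + h)) + 2 D (eta w), with D the translation defect of
    u, gives (m / 2) D (eta h) <= 4 \int_A D (eta w) dw, which the previous lemma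
    bounds by 4 * 4 eta^2 / c times the energy. *)
Lemma translation_defect_le_energy :
  exists2 C : R, (0 < C)%R & exists2 c0 : R, (0 < c0)%R &
  forall (eta : R) u (i : 'I_n) (t : R), (0 < eta <= 1)%R ->
    Defs.periodic u -> measurable_fun [set: 'rV_n] u -> (`|t| <= c0 * eta)%R ->
    translation_defect u (t *: delta_mx ord0 i)%R <= (C * eta ^+ 2)%:E * energy rho eta u.
Proof.
have [c [A [c_gt0 mA AT A0 AJ]]] := admissible_kernel_lower_bound n_gt0 rhoK.
have [c0 c0_gt0 Ac0] := lebesgue_overlap_half mA AT A0.
have Aoo := lebesgue_rV_torus_cell_lty mA AT.
pose m := fine (lebesgue_rV R n A).
have mE : lebesgue_rV R n A = m%:E by rewrite fineK// ge0_fin_numE.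
have m0 : (0 < m)%R by rewrite -lte_fin -mE.
(* 32 = 2 * 4 * 4: the 2 comes from the overlap being half of A. *)
exists (32 / (c * m))%R; first by rewrite divr_gt0// mulr_gt0.
exists c0 => // eta u i t /[dup] eta01 /andP[eta0 eta1] pu mu tc.
pose s := (t / eta)%R; pose h := (s *: delta_mx ord0 i : 'rV[R]_n)%R.
have tE : (t *: delta_mx ord0 i = eta *: h)%R by rewrite scalerA mulrC divfK ?gt_eqF.
have sc : (`|s| <= c0)%R by rewrite normrM normfV (gtr0_norm eta0) ler_pdivrMr.
have := Ac0 i s sc; rewrite mE -EFinM -/h.
set B := A `&` _ => mB.
have mB' : measurable B by apply: measurableI => //; exact: measurable_preimage_translate.
have D0 := translation_defect_ge0 u.
have mD := measurable_translation_defect mu.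
pose g w : \bar R := (\1_A w)%:E * translation_defect u (eta *: w)%R.
have mg : measurable_fun [set: 'rV_n] g.
  apply: emeasurable_funM; first exact/measurable_EFinP.
  by apply: measurableT_comp mD _; exact: measurable_fun_rVZ.
have g0 w : 0 <= g w by rewrite mule_ge0.
have mgh : measurable_fun [set: 'rV_n] (fun w => g (w + h)%R).
  by apply: measurableT_comp mg _; exact: measurable_fun_rVD.
have step : (2^-1 * m)%:E * translation_defect u (t *: delta_mx ord0 i)%R <=
    4%:E * \int[lebesgue_rV R n]_w g w.
  apply: (@le_trans _ _ (\int[lebesgue_rV R n]_w
      ((\1_B w)%:E * translation_defect u (t *: delta_mx ord0 i)%R))).
    rewrite ge0_integralZr//; last exact/measurable_EFinP.
    rewrite -(measure_indicE (lebesgue_rV R n) mB').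
    by apply: lee_wpmul2r.
  have -> : 4%:E * \int[lebesgue_rV R n]_w g w =
      \int[lebesgue_rV R n]_w (2%:E * g (w + h)%R + 2%:E * g w).
    rewrite ge0_integralD//; last 4 first.
    - by move=> w _; rewrite mule_ge0.
    - exact: measurable_funeM.
    - by move=> w _; rewrite mule_ge0.
    - exact: measurable_funeM.
    rewrite !ge0_integralZl//.
    have <- : \int[lebesgue_rV R n]_w g (w + h)%R = \int[lebesgue_rV R n]_w g w.
      rewrite -[RHS](@ge0_integral_rV_affine _ _ 1 h)// expr1n mul1e.
      by apply: eq_integral => w _; rewrite scale1r.
    rewrite -ge0_muleDl//; congr (_%:E * _); lra.
  apply: ge0_le_integral.
  - exact: measurableT.
  - by move=> w _; rewrite mule_ge0.
  - by apply: emeasurable_funM; [exact/measurable_EFinP|exact: measurable_cst].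
  - by apply: emeasurable_funD; exact: measurable_funeM.
  move=> w _; rewrite [in leLHS]indicE; have [/set_mem[Aw Awh]|_] := boolP (w \in B); last first.
    by rewrite mul0e adde_ge0// mule_ge0.
  rewrite mul1e /g !indicE !mem_set// !mul1e scalerDr tE.
  exact: translation_defect_sub.
have := le_trans step (lee_wpmul2l _ (integral_dilated_defect_le c_gt0 eta01 pu mu mA AT AJ)).
move=> /(_ (ltac:(by rewrite lee_fin))).
rewrite muleA -EFinM => H.
have -> : (32 / (c * m) * eta ^+ 2 = (2 / m) * (4 * (4 * eta ^+ 2 / c)))%R.
  by field; rewrite !gt_eqF.
rewrite EFinM -muleA; apply: le_trans (lee_wpmul2l _ H); last by rewrite lee_fin divr_ge0// ltW.
rewrite muleA -EFinM (_ : 2 / m * (2^-1 * m) = 1)%R ?mul1e//.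
by field; rewrite gt_eqF.
Qed.

(** Reach a displacement of size c / r in k equal steps of size at most c eta, where
    k is the integer part of 1 / (eta r): then k^2 eta^2 <= r^-2. *)
Lemma translation_defect_le :
  exists2 C : R, (0 < C)%R & exists2 c : R, (0 < c)%R &
  forall (r eta : R) u (i : 'I_n) (t : R), (1 <= r)%R -> (0 < eta <= 1 / r)%R ->
    Defs.periodic u -> measurable_fun [set: 'rV_n] u -> (`|t| <= c / r)%R ->
    translation_defect u (t *: delta_mx ord0 i)%R <= (C / r ^+ 2)%:E * energy rho eta u.
Proof.
have [C C0 [c c0 H]] := translation_defect_le_energy.
exists C => //; exists (c / 2)%R; first by rewrite divr_gt0.
move=> r eta u i t r1 /andP[eta0 etar] pu mu tc.
have r0 : (0 < r)%R by exact: lt_le_trans r1.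
have etar1 : (eta * r <= 1)%R by rewrite -ler_pdivlMr.
have er0 : (0 < eta * r)%R by rewrite mulr_gt0.
pose k := Num.truncn (eta * r)^-1%R.
have /andP[k1 k2] : (k%:R <= (eta * r)^-1 < k.+1%:R)%R.
  by apply: truncn_itv; rewrite invr_ge0 ltW.
have k_gt0 : (0 < k)%N by rewrite truncn_gt0 invf_ge1.
have kr0 : (1 <= k%:R :> R)%R by rewrite ler1n.
have {}k1 : (k%:R * (eta * r) <= 1)%R by rewrite -ler_pdivlMr// mul1r.
have {}k2 : (1 < k.+1%:R * (eta * r))%R by rewrite -ltr_pdivrMr// mul1r.
have -> : (t *: delta_mx ord0 i = (t / k%:R *: delta_mx ord0 i) *+ k :> 'rV[R]_n)%R.
  by rewrite scalerMnl -mulr_natr divfK// pnatr_eq0 -lt0n.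
apply: (le_trans (translation_defect_mulrn pu mu _ _)).
have tk : (`|t / k%:R| <= c * eta)%R.
  rewrite normrM normfV (ger0_norm (ler0n _ _)) ler_pdivrMr ?ltr0n//.
  apply: (le_trans tc); rewrite ler_pdivrMr//.
  (* The integer part of a number that is at least 1 is at least half of it. *)
  have h : (2^-1 <= k%:R * (eta * r))%R.
    have := ler_wpM2r (ltW er0) kr0; move: k2; rewrite -natr1 mulrDl !mul1r; lra.
  have -> : (c * eta * k%:R * r = c * (k%:R * (eta * r)))%R by ring.
  by rewrite ler_wpM2l// ltW.
have eta1 : (0 < eta <= 1)%R by rewrite eta0/= (le_trans etar)// ler_pdivrMr// mul1r.
apply: (le_trans (lee_wpmul2l _ (H eta u i _ eta1 pu mu tk))).
  by rewrite lee_fin sqr_ge0.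
rewrite muleA -EFinM; apply: lee_wpmul2r.
  rewrite energyE//; apply: mule_ge0 => //; apply: integral_ge0 => z _.
  by rewrite mule_ge0 ?translation_defect_ge0// lee_fin; exact: kernel_ge0.
rewrite lee_fin ler_pdivlMr ?exprn_gt0//.
have -> : (k%:R ^+ 2 * (C * eta ^+ 2) * r ^+ 2 = C * (k%:R * (eta * r)) ^+ 2)%R by ring.
by rewrite ler_piMr ?(ltW C0)// expr_le1// mulr_ge0// ltW.
Qed.

End energy_bound.

End translation_defect.

(** * Bounded functions on finite measure spaces *)

Section bounded_functions.
Context (R : realType).

(** A class closed under products, translations and partial integration, in which
    integrability and Fubini's theorem hold without further conditions. *)
Definition bounded_measurable d (S : measurableType d) (f : S -> R) : Prop :=
  measurable_fun [set: S] f /\ exists M : R, forall s, `|f s| <= M.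

Section closure.
Context d (S : measurableType d).
Implicit Types f g : S -> R.

Lemma bounded_measurable_cst (c : R) : bounded_measurable (fun _ : S => c).
Proof. by split=> //; exists `|c|. Qed.

Lemma bounded_measurableD f g : bounded_measurable f -> bounded_measurable g ->
  bounded_measurable (fun s => f s + g s).
Proof.
move=> [mf [M fM]] [mg [N gN]]; split; first exact: measurable_funD.
by exists (M + N) => s; rewrite (le_trans (ler_normD _ _))// lerD.
Qed.

Lemma bounded_measurableM f g : bounded_measurable f -> bounded_measurable g ->
  bounded_measurable (fun s => f s * g s).
Proof.
move=> [mf [M fM]] [mg [N gN]]; split; first exact: measurable_funM.
by exists (M * N) => s; rewrite normrM ler_pM.
Qed.

Lemma bounded_measurableN f : bounded_measurable f -> bounded_measurable (fun s => - f s).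
Proof.
move=> [mf [M fM]]; split; first exact: measurable_funN.
by exists M => s; rewrite normrN.
Qed.

Lemma bounded_measurableB f g : bounded_measurable f -> bounded_measurable g ->
  bounded_measurable (fun s => f s - g s).
Proof. by move=> bf bg; apply: bounded_measurableD => //; exact: bounded_measurableN. Qed.

Lemma bounded_measurable_sqr f : bounded_measurable f ->
  bounded_measurable (fun s => f s ^+ 2).
Proof. by move=> bf; under eq_fun do rewrite expr2; exact: bounded_measurableM. Qed.

Lemma bounded_measurable_comp d' (S' : measurableType d') (g : S' -> S) f :
  measurable_fun [set: S'] g -> bounded_measurable f -> bounded_measurable (fun s => f (g s)).
Proof.
move=> mg [mf [M fM]]; split; last by exists M.
exact: measurableT_comp mf mg.
Qed.

Variable m : {finite_measure set S -> \bar R}.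

Lemma bounded_measurable_integrable f : bounded_measurable f ->
  m.-integrable [set: S] (EFin \o f).
Proof.
move=> [mf [M fM]]; apply: measurable_bounded_integrable => //.
  by rewrite -ge0_fin_numE// fin_num_measure.
by exists M; split; [rewrite num_real|move=> r Mr s _ /=; rewrite (le_trans (fM s))// ltW].
Qed.

Lemma RintegralE f : bounded_measurable f ->
  (\int[m]_s f s)%:E = (\int[m]_s (f s)%:E)%E.
Proof.
move=> /bounded_measurable_integrable fi; rewrite /Rintegral fineK//.
exact: integrable_fin_num.
Qed.

End closure.
#[local] Hint Resolve bounded_measurable_cst : core.

Section product.
Context d1 d2 (S1 : measurableType d1) (S2 : measurableType d2).
Variables (m1 : {finite_measure set S1 -> \bar R}) (m2 : {finite_measure set S2 -> \bar R}).
Variable f : S1 * S2 -> R.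
Hypothesis bf : bounded_measurable f.

Let bf1 s1 : bounded_measurable (fun s2 => f (s1, s2)).
Proof. by apply: bounded_measurable_comp bf; exact: measurable_pair1. Qed.

Let bf2 s2 : bounded_measurable (fun s1 => f (s1, s2)).
Proof. by apply: bounded_measurable_comp bf; exact: measurable_pair2. Qed.

Let integrable_prod : (m1 \x m2)%E.-integrable [set: S1 * S2] (EFin \o f).
Proof.
case: bf => mf [M fM]; apply: measurable_bounded_integrable => //.
  suff : ((m1 \x m2) setT < +oo)%E by [].
  rewrite -setXTT product_measure1E// lte_mul_pinfty//.
    by rewrite fin_num_measure.
  by rewrite -ge0_fin_numE// fin_num_measure.
by exists M; split; [rewrite num_real|move=> r Mr s _ /=; rewrite (le_trans (fM s))// ltW].
Qed.

Lemma bounded_measurable_Rintegral : bounded_measurable (fun s1 => \int[m2]_s2 f (s1, s2)).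
Proof.
split.
  apply/measurable_EFinP.
  rewrite (_ : _ \o _ = (fubini_F m2 (EFin \o f))); last first.
    by apply/funext => s1; rewrite /= RintegralE.
  exact: measurable_int (integrable_fubini_F integrable_prod).
case: (bf) => mf [M fM]; exists (M * fine (m2 setT)) => s1.
apply: (le_trans (le_normr_Rintegral _ _)) => //; first exact: bounded_measurable_integrable.
rewrite -Rintegral_cst//; apply: le_Rintegral => //.
- apply: (@bounded_measurable_integrable _ _ m2 (fun s2 => `|f (s1, s2)|)).
  split; last by exists M => s; rewrite normr_id.
  by apply: measurableT_comp => //; case: (bf1 s1).
- exact: (@bounded_measurable_integrable _ _ m2 (fun=> M)).
Qed.

Lemma bounded_Fubini :
  \int[m1]_s1 \int[m2]_s2 f (s1, s2) = \int[m2]_s2 \int[m1]_s1 f (s1, s2).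
Proof.
have := Fubini integrable_prod; rewrite /Rintegral => H.
congr fine; transitivity (\int[m1]_x \int[m2]_y (EFin \o f) (x, y))%E.
  by apply: eq_integral => s1 _; rewrite -[in RHS]RintegralE.
by rewrite H; apply: eq_integral => s2 _; rewrite -[in LHS]RintegralE.
Qed.

End product.

End bounded_functions.
#[local] Hint Resolve bounded_measurable_cst : core.

Section torus_pairing.
Context (R : realType) (n : nat).
Notation T := (@torus R n).
Implicit Types u v w phi : 'rV[R]_n -> R.

Definition torus_bounded w : Prop := Defs.periodic w /\ bounded_measurable w.

Lemma Rintegral_torus_translate (h : 'rV[R]_n) w : torus_bounded w ->
  \int[T]_x w (x + h) = \int[T]_x w x.
Proof.
move=> [pw bw]; case: (bw) => mw [M wM].
have bwh : bounded_measurable (fun x : 'rV[R]_n => w (x + h)).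
  by apply: bounded_measurable_comp bw; exact: measurable_fun_rVD.
(* Adding the bound M reduces to nonnegative functions. *)
have H : \int[T]_x (w (x + h) + M) = \int[T]_x (w x + M).
  congr fine; apply: (@ge0_torus_translate R n h (fun x => (w x + M)%:E)).
  - by apply/measurable_EFinP; exact: measurable_funD.
  - by move=> x; rewrite lee_fin; have := wM x; rewrite ler_norml; lra.
  - by move=> i x; rewrite pw.
have iM := @bounded_measurable_integrable _ _ _ T _ (bounded_measurable_cst _ M).
apply: (@addIr _ (\int[T]_x M)).
rewrite -RintegralD//; last exact: bounded_measurable_integrable.
by rewrite -RintegralD//; exact: bounded_measurable_integrable.
Qed.

End torus_pairing.

(** * Averages over segments *)

Section segment.
Context (R : realType).
Notation leb := (@lebesgue_measure R).

Definition segment_measure (d : R) : set (measurableTypeR R) -> \bar R :=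
  mrestr leb (measurable_itv `[- d, d]).

HB.instance Definition _ d := Measure.copy (segment_measure d)
  (mrestr leb (measurable_itv `[- d, d])).

Lemma segment_measureT d : 0 < d -> segment_measure d setT = (2 * d)%:E.
Proof.
move=> d0; rewrite /segment_measure /mrestr setTI /= lebesgue_measure_itv/=.
by rewrite lte_fin gt0_cp// -EFinB; congr EFin; lra.
Qed.

Lemma segment_measure_fin d : fin_num_fun (segment_measure d).
Proof.
move=> A mA; rewrite ge0_fin_numE//.
apply: (@le_lt_trans _ _ (leb `[- d, d]%classic)).
  apply: le_measure; rewrite ?inE; [|exact: measurable_itv|by move=> x []].
  by apply: measurableI => //; exact: measurable_itv.
by rewrite /= lebesgue_measure_itv/=; case: ifPn => // _; rewrite -EFinB ltry.
Qed.

HB.instance Definition _ d := @Measure_isFinite.Build _ _ _ (segment_measure d)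
  (segment_measure_fin d).

Lemma integral_segment d (f : R -> R) : measurable_fun [set: R] f ->
  (\int[segment_measure d]_t (f t)%:E = \int[leb]_(t in `[(- d)%R, d%R]) (f t)%:E)%E.
Proof.
move=> mf; have mEf : measurable_fun [set: R] (EFin \o f) by exact/measurable_EFinP.
rewrite integralE [RHS]integralE; congr (_ - _)%E; apply: ge0_integral_mrestr => //.
- exact: measurable_funepos.
- exact: measurable_funeneg.
Qed.

Lemma Rintegral_segment_cst (d c : R) : 0 < d -> \int[segment_measure d]_t c = 2 * d * c.
Proof.
move=> d0; rewrite Rintegral_cst// mulrC; congr (_ * _).
by rewrite -[RHS]/(fine (2 * d)%:E); congr fine; exact: segment_measureT.
Qed.

Lemma Rintegral_segment_le (d : R) (f : R -> R) (B : R) : 0 < d ->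
  bounded_measurable (f : measurableTypeR R -> R) ->
  (forall t, - d <= t <= d -> f t <= B) ->
  \int[segment_measure d]_t f t <= 2 * d * B.
Proof.
(* The bound is only assumed on the segment, but the measure lives there:
   compare f with g everywhere, and g with B on the segment. *)
move=> d0 bf fB; pose g t := Num.max (f t) B.
have bg : bounded_measurable (g : measurableTypeR R -> R).
  case: bf => mf [M fM]; split; first exact: measurable_maxr.
  exists (Num.max M `|B|) => t; rewrite /g; case: (leP (f t) B) => _.
    by rewrite le_max lexx orbT.
  by rewrite le_max fM.
rewrite -Rintegral_segment_cst//.
rewrite -lee_fin RintegralE// (RintegralE _ (bounded_measurable_cst _ B)).
have -> : (\int[segment_measure d]_t B%:E = \int[segment_measure d]_t (g t)%:E)%E.
  rewrite integral_segment// [RHS]integral_segment; last by case: bg.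
  apply: eq_integral => t /set_mem/=; rewrite in_itv/= => /fB fBt.
  by rewrite /g max_r.
apply: le_integral => //; try exact: bounded_measurable_integrable.
by move=> t _; rewrite lee_fin le_max lexx.
Qed.

End segment.

Section average.
Context (R : realType) (n : nat).
Notation T := (@torus R n).
Variable d : R.
Hypothesis d0 : 0 < d.
Notation seg := (segment_measure d).
Implicit Types (u v w phi : 'rV[R]_n -> R) (e h x : 'rV[R]_n).

Definition average e w x : R := (2 * d)^-1 * \int[seg]_t w (x + t *: e).

Lemma measurable_segment_shift d' (S : measurableType d') (f : S -> 'rV[R]_n) (g : S -> R) e :
  measurable_fun [set: S] f -> measurable_fun [set: S] g ->
  measurable_fun [set: S] (fun s => f s + g s *: e).
Proof.
by move=> mf mg; apply: measurable_fun_rVD => //; exact: measurable_fun_rVZ.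
Qed.

Section one_function.
Variable w : 'rV[R]_n -> R.
Hypothesis bw : torus_bounded w.

Lemma bounded_measurable_segment e x : bounded_measurable (fun t : measurableTypeR R => w (x + t *: e)).
Proof. by apply: bounded_measurable_comp bw.2; exact: measurable_segment_shift. Qed.

Lemma bounded_measurable_translate h : bounded_measurable (fun x : 'rV[R]_n => w (x + h)).
Proof. by apply: bounded_measurable_comp bw.2; exact: measurable_fun_rVD. Qed.

Lemma torus_bounded_translate h : torus_bounded (fun x => w (x + h)).
Proof.
split; last exact: bounded_measurable_translate.
by move=> i x; rewrite addrAC bw.1.
Qed.

Lemma torus_bounded_average e : torus_bounded (average e w).
Proof.
split; first by move=> i x; rewrite /average; under eq_Rintegral do rewrite addrAC bw.1.
apply: bounded_measurableM; first exact: bounded_measurable_cst.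
apply: (@bounded_measurable_Rintegral _ _ _ _ _ T seg
  (fun p : 'rV[R]_n * measurableTypeR R => w (p.1 + p.2 *: e))).
by apply: bounded_measurable_comp bw.2; exact: measurable_segment_shift.
Qed.

Lemma average_cst e (c : R) x : average e (fun=> c) x = c.
Proof.
rewrite /average Rintegral_segment_cst// mulrA mulVf ?mul1r//.
by rewrite gt_eqF// mulr_gt0.
Qed.

End one_function.

Lemma torus_boundedM v w : torus_bounded v -> torus_bounded w ->
  torus_bounded (fun x => v x * w x).
Proof.
move=> [pv bv] [pw bw]; split; first by move=> i x; rewrite pv pw.
exact: bounded_measurableM.
Qed.

Lemma torus_boundedB v w : torus_bounded v -> torus_bounded w ->
  torus_bounded (fun x => v x - w x).
Proof.
move=> [pv bv] [pw bw]; split; first by move=> i x; rewrite pv pw.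
exact: bounded_measurableB.
Qed.

Lemma torus_boundedZ c w : torus_bounded w -> torus_bounded (fun x => c * w x).
Proof.
move=> [pw bw]; split; first by move=> i x; rewrite pw.
by apply: bounded_measurableM => //; exact: bounded_measurable_cst.
Qed.

Lemma torus_bounded_sqr w : torus_bounded w -> torus_bounded (fun x => w x ^+ 2).
Proof. by move=> bw; under eq_fun do rewrite expr2; exact: torus_boundedM. Qed.

Lemma torus_integrable w : torus_bounded w -> T.-integrable [set: 'rV_n] (EFin \o w).
Proof. by move=> [_ bw]; exact: (@bounded_measurable_integrable _ _ _ T). Qed.

Lemma Rintegral_average (F : 'rV[R]_n -> 'rV[R]_n -> R) e :
  bounded_measurable (fun p => F p.1 p.2) ->
  \int[T]_x ((2 * d)^-1 * \int[seg]_t F x (x + t *: e)) =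
  (2 * d)^-1 * \int[seg]_t \int[T]_x F x (x + t *: e).
Proof.
move=> bF.
have bG : bounded_measurable (fun p : 'rV[R]_n * measurableTypeR R => F p.1 (p.1 + p.2 *: e)).
  apply: (bounded_measurable_comp (g := fun p : 'rV[R]_n * measurableTypeR R =>
    (p.1, p.1 + p.2 *: e)) _ bF).
  apply/measurable_fun_pairP; split; first exact: measurable_fst.
  exact: (measurable_segment_shift e measurable_fst measurable_snd).
rewrite RintegralZl//; last first.
  apply: bounded_measurable_integrable.
  exact: (@bounded_measurable_Rintegral _ _ _ _ _ T seg _ bG).
by congr (_ * _); exact: (@bounded_Fubini _ _ _ _ _ T seg _ bG).
Qed.

(** Substitute x - t e for x in the inner integral over the torus.  The adjoint is
    written as an average in the direction -e, which spares reflecting the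
    segment. *)
Lemma average_adjoint e w phi : torus_bounded w -> torus_bounded phi ->
  \int[T]_x (average e w x * phi x) = \int[T]_x (w x * average (- e) phi x).
Proof.
move=> bw bphi.
transitivity (\int[T]_x ((2 * d)^-1 * \int[seg]_t (w (x + t *: e) * phi x))).
  apply: eq_Rintegral => x _; rewrite /average -mulrA; congr (_ * _).
  rewrite -RintegralZr//; apply: bounded_measurable_integrable.
  exact: bounded_measurable_segment.
rewrite (@Rintegral_average (fun x y => w y * phi x)); last first.
  by apply: bounded_measurableM; [apply: bounded_measurable_comp bw.2|apply: bounded_measurable_comp bphi.2].
transitivity (\int[T]_x ((2 * d)^-1 * \int[seg]_t (w x * phi (x + t *: - e)))); last first.
  apply: eq_Rintegral => x _; rewrite /average mulrCA; congr (_ * _).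
  rewrite -RintegralZl//; apply: bounded_measurable_integrable.
  exact: bounded_measurable_segment.
rewrite (@Rintegral_average (fun x y => w x * phi y)); last first.
  by apply: bounded_measurableM; [apply: bounded_measurable_comp bw.2|apply: bounded_measurable_comp bphi.2].
congr (_ * _); apply: eq_Rintegral => t _.
rewrite -(@Rintegral_torus_translate _ _ (t *: e) (fun x => w x * phi (x + t *: - e))).
  by apply: eq_Rintegral => x _; rewrite scalerN addrK.
by apply: torus_boundedM => //; exact: torus_bounded_translate.
Qed.

Lemma Rintegral_torus_average e w : torus_bounded w ->
  \int[T]_x average e w x = \int[T]_x w x.
Proof.
move=> bw; have b1 : torus_bounded (fun _ : 'rV[R]_n => 1 : R).
  by split; [move=> *|exact: bounded_measurable_cst].
have := average_adjoint e bw b1.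
under eq_Rintegral do rewrite mulr1.
by move=> ->; apply: eq_Rintegral => x _; rewrite average_cst mulr1.
Qed.

Lemma average_comm e e' w : torus_bounded w ->
  average e (average e' w) =1 average e' (average e w).
Proof.
move=> bw x; rewrite /average.
have bG : bounded_measurable (fun p : measurableTypeR R * measurableTypeR R =>
    w (x + p.1 *: e + p.2 *: e')).
  apply: bounded_measurable_comp bw.2.
  by do 2 apply: measurable_segment_shift => //.
have bG1 : bounded_measurable (fun s : measurableTypeR R => \int[seg]_t w (x + s *: e + t *: e')).
  exact: (@bounded_measurable_Rintegral _ _ _ _ _ seg seg _ bG).
rewrite RintegralZl//; last exact: bounded_measurable_integrable.
rewrite (@bounded_Fubini _ _ _ _ _ seg seg _ bG)/=.
under eq_Rintegral do under eq_Rintegral do rewrite addrAC.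
rewrite RintegralZl//; last first.
  apply: bounded_measurable_integrable.
  apply: (@bounded_measurable_Rintegral _ _ _ _ _ seg seg
    (fun p : measurableTypeR R * measurableTypeR R => w (x + p.1 *: e' + p.2 *: e))).
  apply: bounded_measurable_comp bw.2.
  by do 2 apply: measurable_segment_shift => //.
Qed.

(** Jensen's inequality, from the nonnegativity of the variance of w along the
    segment. *)
Lemma average_sqr_le e w x : torus_bounded w ->
  average e w x ^+ 2 <= average e (fun y => w y ^+ 2) x.
Proof.
move=> bw; set m := average e w x.
have bs := bounded_measurable_segment bw e x.
have d20 : 2 * d != 0 by rewrite gt_eqF// mulr_gt0.
have mE : \int[seg]_t w (x + t *: e) = 2 * d * m by rewrite /m /average mulrA mulfV// mul1r.
have : 0 <= (2 * d)^-1 * \int[seg]_t (w (x + t *: e) - m) ^+ 2.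
  by rewrite mulr_ge0 ?invr_ge0 ?mulr_ge0// ?(ltW d0)//; apply: Rintegral_ge0 => t _; exact: sqr_ge0.
have -> : \int[seg]_t (w (x + t *: e) - m) ^+ 2 =
    \int[seg]_t (w (x + t *: e) ^+ 2) - 2 * m * (2 * d * m) + 2 * d * m ^+ 2.
  have iw2 := bounded_measurable_integrable seg (bounded_measurable_sqr bs).
  have iw := bounded_measurable_integrable seg bs.
  have im c := bounded_measurable_integrable seg (bounded_measurable_cst (measurableTypeR R) c).
  have imw := bounded_measurable_integrable seg
    (bounded_measurableM (bounded_measurable_cst (measurableTypeR R) (2 * m)) bs).
  transitivity (\int[seg]_t ((w (x + t *: e) ^+ 2 - 2 * m * w (x + t *: e)) + m ^+ 2)).
    by apply: eq_Rintegral => t _; ring.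
  rewrite RintegralD//; last first.
    apply: bounded_measurable_integrable; apply: bounded_measurableB.
      exact: bounded_measurable_sqr.
    by apply: bounded_measurableM => //; exact: bounded_measurable_cst.
  by rewrite RintegralB// RintegralZl// mE Rintegral_segment_cst.
set Q := \int[seg]_t _.
have -> : (2 * d)^-1 * (Q - 2 * m * (2 * d * m) + 2 * d * m ^+ 2) = (2 * d)^-1 * Q - m ^+ 2.
  by field; rewrite gt_eqF.
by rewrite subr_ge0.
Qed.

Lemma average_contraction e w : torus_bounded w ->
  \int[T]_x (average e w x ^+ 2) <= \int[T]_x (w x ^+ 2).
Proof.
move=> bw; rewrite -(Rintegral_torus_average e (torus_bounded_sqr bw)).
apply: le_Rintegral => //.
- exact: torus_integrable (torus_bounded_sqr (torus_bounded_average bw e)).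
- exact: torus_integrable (torus_bounded_average (torus_bounded_sqr bw) e).
- by move=> x _; exact: average_sqr_le.
Qed.

(** By Jensen (w x - average e w x)^2 is at most the mean of (w (x + t e) - w x)^2
    over t; integrate in x first. *)
Lemma average_defect e w (B : R) : torus_bounded w ->
  (forall t, `|t| <= d -> \int[T]_x ((w (x + t *: e) - w x) ^+ 2) <= B) ->
  \int[T]_x ((w x - average e w x) ^+ 2) <= B.
Proof.
move=> bw wB; have ba := torus_bounded_average bw e.
have bF : bounded_measurable (fun p : 'rV[R]_n * 'rV[R]_n => (w p.2 - w p.1) ^+ 2).
  by apply: bounded_measurable_sqr; apply: bounded_measurableB; apply: bounded_measurable_comp bw.2.
have bG : bounded_measurable (fun p : 'rV[R]_n * measurableTypeR R => (w (p.1 + p.2 *: e) - w p.1) ^+ 2).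
  apply: bounded_measurable_sqr; apply: bounded_measurableB; apply: bounded_measurable_comp bw.2.
    exact: measurable_segment_shift.
  exact: measurable_fst.
apply: (@le_trans _ _ (\int[T]_x ((2 * d)^-1 * \int[seg]_t (w (x + t *: e) - w x) ^+ 2))).
  apply: le_Rintegral => //.
  - exact: torus_integrable (torus_bounded_sqr (torus_boundedB bw ba)).
  - apply: (@bounded_measurable_integrable _ _ _ T); apply: bounded_measurableM.
      exact: bounded_measurable_cst.
    exact: (@bounded_measurable_Rintegral _ _ _ _ _ T seg _ bG).
  move=> x _; have bv : torus_bounded (fun y => w y - w x).
    apply: torus_boundedB => //; split => //; exact: bounded_measurable_cst.
  apply: le_trans (average_sqr_le e x bv); rewrite -sqrrN opprB le_eqVlt; apply/orP; left.
  apply/eqP; congr (_ ^+ 2); rewrite {2}/average.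
  rewrite RintegralB//; last 2 first.
  - exact: bounded_measurable_integrable (bounded_measurable_segment bw e x).
  - exact: bounded_measurable_integrable (bounded_measurable_cst _ _).
  rewrite Rintegral_segment_cst// mulrBr mulrA mulVf ?mul1r//.
  by rewrite gt_eqF// mulr_gt0.
rewrite (@Rintegral_average (fun x y => (w y - w x) ^+ 2))//.
rewrite mulrC ler_pdivrMr ?mulr_gt0// [leRHS]mulrC.
apply: Rintegral_segment_le => //; last by move=> t td; apply: wB; rewrite ler_norml.
apply: (@bounded_measurable_Rintegral _ _ _ _ _ seg T
  (fun p : measurableTypeR R * 'rV[R]_n => (w (p.2 + p.1 *: e) - w p.2) ^+ 2)).
apply: (bounded_measurable_comp (g := fun p : measurableTypeR R * 'rV[R]_n => (p.2, p.1)) _ bG).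
by apply/measurable_fun_pairP; split; [exact: measurable_snd|exact: measurable_fst].
Qed.

Definition difference_quotient e w x : R := (2 * d)^-1 * (w (x + d *: e) - w (x - d *: e)).

Lemma torus_bounded_difference_quotient e w : torus_bounded w ->
  torus_bounded (difference_quotient e w).
Proof.
by move=> bw; apply: torus_boundedZ; apply: torus_boundedB; exact: torus_bounded_translate.
Qed.

(** Discrete integration by parts. *)
Lemma difference_quotient_skew e w phi : torus_bounded w -> torus_bounded phi ->
  \int[T]_x (w x * difference_quotient e phi x) =
  - \int[T]_x (difference_quotient e w x * phi x).
Proof.
move=> bw bphi; have bt h := torus_bounded_translate bw h; have btp h := torus_bounded_translate bphi h.
have i1 h := torus_integrable (torus_boundedM bw (btp h)).
have i2 h := torus_integrable (torus_boundedM (bt h) bphi).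
have key h : \int[T]_x (w x * phi (x + h)) = \int[T]_x (w (x - h) * phi x).
  rewrite -(@Rintegral_torus_translate _ _ h (fun x => w (x - h) * phi x)).
    by apply: eq_Rintegral => x _; rewrite addrK.
  exact: torus_boundedM.
transitivity ((2 * d)^-1 * \int[T]_x (w x * phi (x + d *: e) - w x * phi (x - d *: e))).
  rewrite -RintegralZl//; last by apply: torus_integrable; apply: torus_boundedB; apply: torus_boundedM.
  by apply: eq_Rintegral => x _; rewrite /difference_quotient mulrCA mulrBr.
transitivity (- ((2 * d)^-1 * \int[T]_x (w (x + d *: e) * phi x - w (x - d *: e) * phi x))).
  rewrite -mulrN; congr (_ * _); rewrite !RintegralB// !key opprK; ring.
congr (- _); rewrite -RintegralZl//; last first.
  by apply: torus_integrable; apply: torus_boundedB; apply: torus_boundedM.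
by apply: eq_Rintegral => x _; rewrite /difference_quotient -mulrA mulrBl.
Qed.

Lemma difference_quotient_sqr_le e w : torus_bounded w ->
  \int[T]_x (difference_quotient e w x ^+ 2) <= d ^- 2 * \int[T]_x (w x ^+ 2).
Proof.
move=> bw; have b2 h := torus_bounded_sqr (torus_bounded_translate bw h).
have i2 h := torus_integrable (b2 h).
have N h : \int[T]_x (w (x + h) ^+ 2) = \int[T]_x (w x ^+ 2).
  exact: (@Rintegral_torus_translate _ _ h (fun x => w x ^+ 2)) (torus_bounded_sqr bw).
have -> : d ^- 2 * \int[T]_x (w x ^+ 2) =
    \int[T]_x (2^-1 * d ^- 2 * (w (x + d *: e) ^+ 2 + w (x - d *: e) ^+ 2)).
  rewrite RintegralZl//; last first.
    apply: (@bounded_measurable_integrable _ _ _ T).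
    by apply: bounded_measurableD; [case: (b2 (d *: e))|case: (b2 (- (d *: e)))].
  rewrite RintegralD// !N; lra.
apply: le_Rintegral => //.
- exact: torus_integrable (torus_bounded_sqr (torus_bounded_difference_quotient e bw)).
- apply: (@bounded_measurable_integrable _ _ _ T); apply: bounded_measurableM.
    exact: bounded_measurable_cst.
  by apply: bounded_measurableD; [case: (b2 (d *: e))|case: (b2 (- (d *: e)))].
move=> x _; rewrite /difference_quotient exprMn invfM exprMn exprVn.
set a := w _; set b := w _.
have d2 : 0 <= d ^- 2 by rewrite invr_ge0 sqr_ge0.
have := mulr_ge0 d2 (sqr_ge0 (a + b)); rewrite exprVn.
nra.
Qed.

Lemma averageB e v w x : torus_bounded v -> torus_bounded w ->
  average e (fun y => v y - w y) x = average e v x - average e w x.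
Proof.
move=> bv bw; rewrite /average RintegralB ?mulrBr//;
  exact: bounded_measurable_integrable (bounded_measurable_segment _ e x).
Qed.

Notation delta i := (delta_mx ord0 i : 'rV[R]_n).

(** Averages in several coordinate directions, and their adjoints. *)
Definition averages (s : seq 'I_n) w := foldr (fun i => average (delta i)) w s.
Definition coaverages (s : seq 'I_n) w := foldr (fun i => average (- delta i)) w s.

Lemma torus_bounded_averages s w : torus_bounded w -> torus_bounded (averages s w).
Proof. by move=> bw; elim: s => //= i s IH; exact: torus_bounded_average. Qed.

Lemma torus_bounded_coaverages s w : torus_bounded w -> torus_bounded (coaverages s w).
Proof. by move=> bw; elim: s => //= i s IH; exact: torus_bounded_average. Qed.

Lemma coaverages_contraction s w : torus_bounded w ->
  \int[T]_x (coaverages s w x ^+ 2) <= \int[T]_x (w x ^+ 2).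
Proof.
move=> bw; elim: s => //= i s IH; apply: le_trans IH.
by apply: average_contraction; exact: torus_bounded_coaverages.
Qed.

(** With P the first average and Q the composite of the others, write
    w - P Q w = (w - P w) + P (w - Q w), and use (a + b)^2 <= 2 a^2 + 2 b^2 and
    the contractivity of P: the constants obey 2 + 2 * 4^k <= 4^(k+1). *)
Lemma averages_defect s w (B : R) : torus_bounded w -> 0 <= B ->
  (forall i t, `|t| <= d -> \int[T]_x ((w (x + t *: delta i) - w x) ^+ 2) <= B) ->
  \int[T]_x ((w x - averages s w x) ^+ 2) <= 4 ^+ size s * B.
Proof.
move=> bw B0 wB; elim: s => [|i s IH] /=.
  under eq_Rintegral do rewrite subrr expr0n/=.
  by rewrite Rintegral_cst// mul0r mul1r.
have bs := torus_bounded_averages s bw; have bd := torus_boundedB bw bs.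
have b1 := torus_boundedB bw (torus_bounded_average bw (delta i)).
have b2 := torus_bounded_average bd (delta i).
have i1 := torus_integrable (torus_bounded_sqr b1).
have i2 := torus_integrable (torus_bounded_sqr b2).
apply: (@le_trans _ _ (2 * \int[T]_x ((w x - average (delta i) w x) ^+ 2) +
   2 * \int[T]_x (average (delta i) (fun y => w y - averages s w y) x ^+ 2))).
  rewrite -!RintegralZl// -RintegralD//; last 2 first.
  - exact: torus_integrable (torus_boundedZ 2 (torus_bounded_sqr b1)).
  - exact: torus_integrable (torus_boundedZ 2 (torus_bounded_sqr b2)).
  apply: le_Rintegral => //.
  - exact: torus_integrable (torus_bounded_sqr (torus_boundedB bw (torus_bounded_average bs _))).
  - apply: (@bounded_measurable_integrable _ _ _ T); apply: bounded_measurableD.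
      exact: (torus_boundedZ 2 (torus_bounded_sqr b1)).2.
    exact: (torus_boundedZ 2 (torus_bounded_sqr b2)).2.
  move=> x _; rewrite averageB//.
  set a := average _ w x; set b := average _ _ x.
  by have := sqr_ge0 (w x - a - (a - b)); nra.
have h1 := average_defect bw (wB i).
have h2 := le_trans (average_contraction (delta i) bd) IH.
rewrite exprS; have : B <= 4 ^+ size s * B by rewrite ler_peMl// exprn_ege1// ler1n.
lra.
Qed.

Lemma coaverages_comm s i w : torus_bounded w ->
  coaverages s (average (- delta i) w) = average (- delta i) (coaverages s w).
Proof.
move=> bw; elim: s => //= j s ->; apply/funext => x.
by apply: average_comm; exact: torus_bounded_coaverages.
Qed.

(** Averages commute, so any direction of the list can be brought to the front. *)
Lemma coaverages_rem s i w : torus_bounded w -> i \in s ->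
  coaverages s w = average (- delta i) (coaverages (rem i s) w).
Proof.
move=> bw; elim: s => //= j s IH; rewrite inE.
case: eqVneq => [->//|ji /=]; rewrite eq_sym in ji.
move=> /IH ->; apply/funext => x; apply: average_comm.
exact: torus_bounded_coaverages.
Qed.

Lemma averages_adjoint s w phi : torus_bounded w -> torus_bounded phi ->
  \int[T]_x (averages s w x * phi x) = \int[T]_x (w x * coaverages s phi x).
Proof.
move=> bw; elim: s phi => //= i s IH phi bphi.
rewrite average_adjoint//; last exact: torus_bounded_averages.
by rewrite IH ?coaverages_comm//; exact: torus_bounded_average.
Qed.

End average.

(** * Test functions *)

Lemma Rintegral_segment_derive1 (R : realType) (d : R) (F G : R -> R) : 0 < d ->
  continuous G -> (forall t, derivable F t 1) -> (forall t, derive1 F t = G t) ->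
  \int[segment_measure d]_t G t = F d - F (- d).
Proof.
move=> d0 cG dF F'G.
have cF t : {for t, continuous F} by apply/differentiable_continuous/derivable1_diffP.
transitivity (fine ((F d)%:E - (F (- d))%:E)%E) => //; congr fine.
rewrite integral_segment; last exact: continuous_measurable_fun.
apply: continuous_FTC2.
- lra.
- exact: continuous_subspaceT.
- split; first by move=> t _; exact: dF.
  + by apply: cvg_at_right_filter; exact: cF.
  + by apply: cvg_at_left_filter; exact: cF.
- by move=> t _; exact: F'G.
Qed.

Section test_functions.
Context (R : realType) (n : nat).
Notation T := (@torus R n).
Notation delta i := (delta_mx ord0 i : 'rV[R]_n).
Implicit Types (f phi : 'rV[R]_n -> R) (x : 'rV[R]_n).

Lemma rV_norm_lt x (e : R) : 0 < e -> (forall i, `|x ord0 i| < e) -> `|x| < e.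
Proof.
move=> e0 xe; rewrite -[`|x|]/(mx_norm x); have [->//|/mx_norm_neq0[[i j] ->]] := eqVneq (mx_norm x) 0.
by rewrite ord1 /= xe.
Qed.

(** The lattice of mesh 1 / (m + 1), which discretises functions on R^n. *)
Definition grid_index (m : nat) x : {ffun 'I_n -> int} :=
  [ffun i => Num.floor (x ord0 i * m.+1%:R)].

Definition grid_point (m : nat) (g : {ffun 'I_n -> int}) : 'rV[R]_n :=
  \row_i ((g i)%:~R / m.+1%:R).

Lemma measurable_grid_index m g : measurable [set x | grid_index m x = g].
Proof.
rewrite (_ : [set x | _] = \bigcap_(i in [set: 'I_n])
    (@coord_rV R n i @^-1` [set t | Num.floor (t * m.+1%:R) = g i])).
  apply: fin_bigcap_measurable => // i _.
  rewrite -[X in measurable X]setTI; apply: measurable_coord_rV => //.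
  rewrite (_ : [set t | _] = `[(g i)%:~R / m.+1%:R, (g i + 1)%:~R / m.+1%:R[%classic).
    exact: measurable_itv.
  apply/seteqP; split => t /=; rewrite in_itv/= ler_pdivrMr// ltr_pdivlMr//.
    by move=> /eqP; rewrite floor_eq.
  by rewrite -floor_eq => /eqP.
apply/seteqP; split => x /= H.
  by move=> i _; rewrite /= -H ffunE.
by apply/ffunP => i; rewrite ffunE; exact: H.
Qed.

Lemma grid_point_cvg x : grid_point m (grid_index m x) @[m --> \oo] --> x.
Proof.
apply/cvgrPdist_lt => e e0.
have [k _ ke] := near_infty_natSinv_lt (PosNum e0).
exists k => // m km; apply: rV_norm_lt => // i; rewrite !mxE ffunE.
apply: le_lt_trans (ke m km); set y := x ord0 i * m.+1%:R.
have -> : x ord0 i = y / m.+1%:R by rewrite mulfK.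
rewrite -mulrBl normrM normfV (ger0_norm (ler0n _ _)) ler_piMl ?invr_ge0//.
have := floor_itv y; rewrite intrD ler_norml; lra.
Qed.

(** The measurable sets of R^n are generated by the coordinates, not by the open
    sets.  A continuous f is the pointwise limit of its values at lattice points,
    and these approximations take countably many values, on products of
    intervals. *)
Lemma continuous_rV_measurable f : continuous f -> measurable_fun [set: 'rV_n] f.
Proof.
move=> cf; apply: (@measurable_fun_cvg _ _ _ _ (fun m x => f (grid_point m (grid_index m x)))).
  move=> m _ Y mY; rewrite setTI.
  rewrite (_ : _ @^-1` _ = \bigcup_(g in [set: {ffun 'I_n -> int}])
     (if `[< Y (f (grid_point m g)) >] then [set x | grid_index m x = g] else set0)).
    apply: countable_bigcupT_measurable => [|g]; first exact: countableP.
    by case: ifPn => // _; exact: measurable_grid_index.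
  apply/seteqP; split => [x /= Yx|x [g _]].
    by exists (grid_index m x) => //; rewrite asboolT.
  by case: ifPn => // /asboolP Yg /= ->.
by move=> x _; exact: (cvg_comp _ _ (@grid_point_cvg x) (cf x)).
Qed.

Lemma periodic_torus_repr f x : Defs.periodic f -> f (torus_repr x) = f x.
Proof.
move=> pf; pose k i := - Num.floor ((x ord0 i + pi) / (2 * pi)).
have -> : torus_repr x = x + \sum_i (2 * pi * (k i)%:~R) *: delta i.
  apply/rowP => i; rewrite !mxE summxE (bigD1 i)//= !mxE !eqxx mulr1.
  rewrite big1 ?addr0 ?mulrNz ?mulrN// => j ji.
  by rewrite !mxE eqxx/= eq_sym (negbTE ji) mulr0.
move: k => k; elim: (index_enum _) x => [|i s IH] y; first by rewrite big_nil addr0.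
rewrite big_cons addrA IH.
have h (t : R) : f (y + (t + 2 * pi) *: delta i) = f (y + t *: delta i).
  by rewrite scalerDl addrA pf.
by have := periodic_int h (k i) 0; rewrite add0r scale0r addr0.
Qed.

(** Every value is attained in the closed cell, which is compact. *)
Lemma continuous_periodic_torus_bounded f : continuous f -> Defs.periodic f -> torus_bounded f.
Proof.
move=> cf pf; split => //; split; first exact: continuous_rV_measurable.
have cK : compact [set v : 'rV[R]_n | forall i, `[- pi, pi]%classic (v ord0 i)].
  by apply: (@rV_compact _ n (fun=> `[- pi, pi]%classic)) => i; exact: segment_compact.
have /compact_bounded[M [_ HM]] := continuous_compact (continuous_subspaceT cf) cK.
exists (M + 1) => x; rewrite -(periodic_torus_repr x pf).
apply: (HM (M + 1)); first by rewrite ltrDl.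
exists (torus_repr x) => // i; rewrite /= in_itv/= mxE.
have pi2 : 0 < 2 * pi :> R by rewrite mulr_gt0// pi_gt0.
have := floor_itv ((x ord0 i + pi) / (2 * pi)); set k := (Num.floor _).
rewrite intrD ler_pdivlMr// ltr_pdivrMr// => /andP[h1 h2].
by apply/andP; split; lra.
Qed.

(** The fundamental theorem of calculus along the segment. *)
Lemma average_partial (d : R) i phi x : 0 < d -> smooth phi -> Defs.periodic phi ->
  average d (delta i) (partial i phi) x = difference_quotient d (delta i) phi x.
Proof.
move=> d0 sphi pphi.
have [cphi dphi] := sphi [::]; have [cpart _] := sphi [:: i].
pose F (t : R) := phi (x + t *: delta i).
pose G (t : R) := partial i phi (x + t *: delta i).
have shift_cont : continuous (fun t : R => x + t *: delta i).
  by move=> t; apply: cvgD; [exact: cvg_cst|apply: cvgZr_tmp; exact: cvg_id].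
have cG : continuous G.
  by move=> t; apply: continuous_comp; [exact: shift_cont|exact: cpart].
have quot t : (fun h : R => h^-1 *: ((F \o shift t) (h *: 1) - F t)) =
    (fun h => h^-1 *: ((phi \o shift (x + t *: delta i)) (h *: delta i) - phi (x + t *: delta i))).
  apply/funext => h; congr (_ *: (phi _ - _)) => /=.
  by rewrite /shift/= addrCA -scalerDl -[h *: 1]/(h * 1) mulr1.
have dF t : derivable F t 1.
  by rewrite /derivable quot; exact: dphi.
have F'G t : derive1 F t = G t.
  by rewrite derive1E /derive quot.
rewrite /average /difference_quotient; congr (_ * _).
by rewrite (Rintegral_segment_derive1 d0 cG dF F'G) /F scaleNr.
Qed.

End test_functions.

(** * Duality with H^1 *)

Section norms.
Context (R : realType) (n : nat).
Notation T := (@torus R n).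
Notation delta i := (delta_mx ord0 i : 'rV[R]_n).
Implicit Types u v w phi : 'rV[R]_n -> R.

Lemma poweR2 (x : \bar R) : (0 <= x)%E -> (x `^ 2 = x ^+ 2)%E.
Proof.
case: x => [r|_|//]; last by rewrite poweRyr ?gt_eqF.
by rewrite lee_fin poweR_EFin => r0; rewrite powR_mulrn.
Qed.

Lemma L2_norm_sqr u : (L2_norm u ^+ 2 = \int[T]_x (u x ^+ 2)%:E)%E.
Proof.
rewrite -poweR2 ?Lnorm_ge0// /L2_norm powR_Lnorm ?gt_eqF//.
apply: eq_integral => x _ /=.
by rewrite powR_mulrn// real_normK ?num_real.
Qed.

Lemma L2_norm_sqr_bounded w : torus_bounded w -> (L2_norm w ^+ 2 = (\int[T]_x (w x ^+ 2))%:E)%E.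
Proof.
by move=> bw; rewrite L2_norm_sqr RintegralE//; exact: (torus_bounded_sqr bw).2.
Qed.

Lemma torus_bounded_L2 w : torus_bounded w -> L2_torus w.
Proof.
move=> bw; split; first exact: bw.1.
rewrite inE; apply/andP; split; rewrite inE; first exact: bw.2.1.
suff : (L2_norm w < +oo)%E by [].
rewrite ltNge leye_eq; apply/negP => /eqP woo.
by have := L2_norm_sqr_bounded bw; rewrite woo.
Qed.

Lemma partial_periodic i phi : Defs.periodic phi -> Defs.periodic (partial i phi).
Proof.
move=> pphi j x; rewrite /partial /derive.
rewrite (_ : (fun h : R => _) = (fun h : R => h^-1 *: ((phi \o shift x) (h *: delta i) - phi x)))//.
by apply/funext => h; rewrite pphi /= /shift/= addrA pphi.
Qed.

Lemma torus_bounded_test phi : smooth phi -> Defs.periodic phi ->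
  torus_bounded phi /\ forall i, torus_bounded (partial i phi).
Proof.
move=> sphi pphi; split=> [|i]; apply: continuous_periodic_torus_bounded => //.
- exact: (sphi [::]).1.
- exact: (sphi [:: i]).1.
- exact: partial_periodic.
Qed.

(** Apply the definition of the dual norm to v / sqrt S, whose H^1 norm is at
    most 1. *)
Lemma pairing_le_Hm1 u v (g : 'I_n -> 'rV[R]_n -> R) (S : R) :
  torus_bounded v -> (forall i, torus_bounded (g i)) ->
  weak_gradient (@lebesgue_torus R n) [set phi | smooth phi /\ Defs.periodic phi] v g ->
  T.-integrable [set: 'rV_n] (fun x => (u x * v x)%:E) ->
  0 < S -> \int[T]_x (v x ^+ 2) + \sum_i \int[T]_x (g i x ^+ 2) <= S ->
  (`| \int[T]_x (u x * v x) |%:E <= (Num.sqrt S)%:E * Hm1_norm u)%E.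
Proof.
move=> bv bg vg iuv S0 vS; set s := Num.sqrt S.
have s0 : 0 < s by rewrite sqrtr_gt0.
have sS : s ^- 2 * S = 1 by rewrite sqr_sqrtr ?(ltW S0)// mulVf// gt_eqF.
pose v' x := s^-1 * v x; pose g' i x := s^-1 * g i x.
have bv' : torus_bounded v' by exact: torus_boundedZ.
have bg' i : torus_bounded (g' i) by exact: torus_boundedZ.
have sqZ w : torus_bounded w -> \int[T]_x ((s^-1 * w x) ^+ 2) = s ^- 2 * \int[T]_x (w x ^+ 2).
  move=> bw; rewrite -RintegralZl//; last exact: torus_integrable (torus_bounded_sqr bw).
  by apply: eq_Rintegral => x _; rewrite exprMn exprVn.
have : ((`| \int[T]_x (u x * v' x) |)%:E <= Hm1_norm u)%E.
  apply: ereal_sup_ubound; exists (v', g') => //; split.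
    split; [exact: torus_bounded_L2|by move=> i; exact: torus_bounded_L2|].
    move=> phi [sphi pphi] i; have [bphi bpart] := torus_bounded_test sphi pphi.
    change (\int[T]_x (v' x * partial i phi x) = - \int[T]_x (g' i x * phi x)).
    under eq_Rintegral do rewrite /v' -mulrA.
    under [in RHS]eq_Rintegral do rewrite /g' -mulrA.
    rewrite !RintegralZl//; last 2 first.
    - exact: torus_integrable (torus_boundedM (bg i) bphi).
    - exact: torus_integrable (torus_boundedM bv (bpart i)).
    by rewrite -mulrN; congr (_ * _); exact: vg.
  rewrite /H1_norm L2_norm_sqr_bounded//.
  under eq_bigr do rewrite L2_norm_sqr_bounded//.
  rewrite sumEFin -EFinD poweR_EFin lee_fin -[leRHS](congr1 (@^~ 2^-1) (powR1 R)).
  apply: ge0_ler_powR => //.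
  - by rewrite nnegrE addr_ge0 ?sumr_ge0// => *; apply: Rintegral_ge0 => x _; exact: sqr_ge0.
  - by rewrite nnegrE.
  rewrite sqZ//; under eq_bigr do rewrite sqZ//.
  by rewrite -mulr_sumr -mulrDr -sS ler_pM2l// invr_gt0 exprn_gt0.
have -> : \int[T]_x (u x * v' x) = s^-1 * \int[T]_x (u x * v x).
  by rewrite -RintegralZl//; apply: eq_Rintegral => x _; rewrite /v' mulrCA.
rewrite normrM (gtr0_norm (_ : 0 < s^-1)) ?invr_gt0// => H.
have -> : (`|\int[T]_x (u x * v x)|%:E = s%:E * (s^-1 * `|\int[T]_x (u x * v x)|)%:E)%E.
  by rewrite -EFinM mulrA mulfV ?gt_eqF// mul1r.
by apply: lee_wpmul2l => //; rewrite lee_fin ltW.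
Qed.

(** Move the average in direction i from the function onto the test function; there
    it turns the partial derivative into a difference quotient, which is then moved
    back by discrete integration by parts. *)
Lemma weak_gradient_coaverages d (s : seq 'I_n) w : 0 < d -> (forall i, i \in s) ->
  torus_bounded w ->
  weak_gradient (@lebesgue_torus R n) [set phi | smooth phi /\ Defs.periodic phi]
    (coaverages d s w)
    (fun i => difference_quotient d (delta i) (coaverages d (rem i s) w)).
Proof.
move=> d0 si bw phi [sphi pphi] i.
have bc := torus_bounded_coaverages d (rem i s) bw.
have [bphi bpart] := torus_bounded_test sphi pphi.
rewrite (coaverages_rem d bw (si i)).
change (\int[T]_x (average d (- delta i) (coaverages d (rem i s) w) x * partial i phi x) =
  - \int[T]_x (difference_quotient d (delta i) (coaverages d (rem i s) w) x * phi x)).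
rewrite average_adjoint// opprK -difference_quotient_skew//.
by apply: eq_Rintegral => x _; rewrite average_partial.
Qed.

End norms.

(** * The averaged function and truncations *)

Section main_estimate.
Context (R : realType) (n : nat).
Notation T := (@torus R n).
Notation delta i := (delta_mx ord0 i : 'rV[R]_n).
Implicit Types u v b : 'rV[R]_n -> R.

Lemma L2_torus_sqr_integrable u : L2_torus u ->
  T.-integrable [set: 'rV_n] (fun x => (u x ^+ 2)%:E).
Proof.
move=> [_ /[!inE]/andP[/[!inE]/= mu uoo]]; apply/integrableP; split.
  by apply/measurable_EFinP; exact: measurable_funX.
have : (L2_norm u ^+ 2 < +oo)%E.
  have : L2_norm u \is a fin_num by rewrite ge0_fin_numE ?Lnorm_ge0.
  by move/fineK => <-; rewrite -EFin_expe ltry.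
rewrite L2_norm_sqr; apply: le_lt_trans; rewrite le_eqVlt; apply/orP; left; apply/eqP.
by apply: eq_integral => x _; rewrite gee0_abs// lee_fin sqr_ge0.
Qed.

Lemma L2_torus_integrable u : L2_torus u -> T.-integrable [set: 'rV_n] (EFin \o u).
Proof.
move=> uL2; have [_ /[!inE]/andP[/[!inE]/= mu _]] := uL2.
apply: (@le_integrable _ _ _ T _ measurableT _ (fun x => ((1:R)%:E + (u x ^+ 2)%:E)%E)).
- exact/measurable_EFinP.
- move=> x _; rewrite /= lee_fin [leRHS]ger0_norm ?addr_ge0 ?sqr_ge0//.
  rewrite -(real_normK (num_real (u x))).
  by have := sqr_ge0 (`|u x| - 1); have := normr_ge0 (u x); nra.
apply: integrableD => //; last exact: L2_torus_sqr_integrable.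
exact: (@bounded_measurable_integrable _ _ _ T _ (bounded_measurable_cst _ 1)).
Qed.

Lemma integrable_mul_bounded u v : measurable_fun [set: 'rV_n] u -> T.-integrable [set: 'rV_n] (EFin \o u) ->
  torus_bounded v -> T.-integrable [set: 'rV_n] (fun x => (u x * v x)%:E).
Proof.
move=> mu iu [_ [mv [M vM]]].
apply: (@le_integrable _ _ _ T _ measurableT _ (fun x => (M%:E * (EFin \o u) x)%E)).
- by apply/measurable_EFinP; exact: measurable_funM.
- move=> x _; rewrite /= lee_fin !normrM mulrC ler_wpM2r//.
  by rewrite (le_trans (vM x))// ler_norm.
exact: integrableZl.
Qed.

(** Let A b be the averaged function, a its squared L^2 norm and v the adjoint
    averages of A b, so that a = <b, v> = <u, v> - <u - b, v>.  As v has squared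
    H^1 norm at most k a with k = 1 + n d^-2, duality gives
    <u, v> <= sqrt (k a) H.  Young's inequality bounds both terms at the price of
    a / 4 each, which the left-hand side absorbs. *)
Lemma averages_sqr_le (d H : R) u b : 0 < d -> L2_torus u -> torus_bounded b ->
  T.-integrable [set: 'rV_n] (fun x => ((u x - b x) ^+ 2)%:E) ->
  Hm1_norm u = H%:E ->
  \int[T]_x (averages d (enum 'I_n) b x ^+ 2) <=
  2 * (1 + n%:R * d ^- 2) * H ^+ 2 + 2 * \int[T]_x ((u x - b x) ^+ 2).
Proof.
move=> d0 uL2 bb iub uH; set A := averages d _ b; set a := \int[T]_x (A x ^+ 2).
set k := 1 + _; set D := \int[T]_x ((u x - b x) ^+ 2).
have k1 : 1 <= k by rewrite lerDl mulr_ge0// invr_ge0 sqr_ge0.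
have D0 : 0 <= D by apply: Rintegral_ge0 => x _; exact: sqr_ge0.
have : 0 <= a by apply: Rintegral_ge0 => x _; exact: sqr_ge0.
rewrite le_eqVlt => /predU1P[<-|a0].
  by have := mulr_ge0 (le_trans ler01 k1) (sqr_ge0 H); lra.
have bA : torus_bounded A by exact: torus_bounded_averages.
set v := coaverages d (enum 'I_n) A.
have bv : torus_bounded v by exact: torus_bounded_coaverages.
have mem i : i \in enum 'I_n by rewrite mem_enum.
have [_ /[!inE]/andP[/[!inE]/= mu _]] := uL2.
have iu := L2_torus_integrable uL2.
have iuv := integrable_mul_bounded mu iu bv.
have ibv := torus_integrable (torus_boundedM bb bv).
have iv2 := torus_integrable (torus_bounded_sqr bv).
have va : \int[T]_x (v x ^+ 2) <= a by exact: coaverages_contraction.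
have ga i : \int[T]_x (difference_quotient d (delta i) (coaverages d (rem i (enum 'I_n)) A) x ^+ 2)
    <= d ^- 2 * a.
  apply: le_trans (difference_quotient_sqr_le _ _ (torus_bounded_coaverages d _ bA)) _.
  by rewrite ler_wpM2l ?invr_ge0 ?sqr_ge0//; exact: coaverages_contraction.
have Suv : \int[T]_x (v x ^+ 2) + \sum_i \int[T]_x
    (difference_quotient d (delta i) (coaverages d (rem i (enum 'I_n)) A) x ^+ 2) <= k * a.
  rewrite mulrDl mul1r lerD// -mulrA mulr_natl -[n in _ *+ n]card_ord -sumr_const.
  by apply: ler_sum => i _; exact: ga.
have ka : 0 < k * a by rewrite mulr_gt0// (lt_le_trans ltr01).
have := pairing_le_Hm1 bv (fun i => torus_bounded_difference_quotient d (delta i)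
  (torus_bounded_coaverages d _ bA)) (weak_gradient_coaverages d0 mem bA) iuv ka Suv.
rewrite uH -EFinM lee_fin; set r := Num.sqrt _ => uvr.
have r2 : r ^+ 2 = k * a by rewrite sqr_sqrtr ?ltW.
have aE : a = \int[T]_x (u x * v x) - \int[T]_x ((u x - b x) * v x).
  transitivity (\int[T]_x (b x * v x)).
    by rewrite /v -averages_adjoint//; apply: eq_Rintegral => x _; rewrite expr2.
  under [X in _ = _ - X]eq_Rintegral do rewrite mulrBl.
  by rewrite RintegralB// opprB addrC subrK.
have dv : - (\int[T]_x ((u x - b x) * v x)) <= D + 4^-1 * \int[T]_x (v x ^+ 2).
  have iubv : T.-integrable [set: 'rV_n] (fun x => ((u x - b x) * v x)%:E).
    rewrite (_ : (fun _ => _) = (fun x => ((u x * v x)%:E - (b x * v x)%:E)%E)).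
      exact: integrableB.
    by apply/funext => x; rewrite mulrBl EFinB.
  have : 0 <= \int[T]_x ((u x - b x) ^+ 2 + ((u x - b x) * v x + 4^-1 * v x ^+ 2)).
    apply: Rintegral_ge0 => x _.
    by have := sqr_ge0 (u x - b x + 2^-1 * v x); nra.
  have iv4 := torus_integrable (torus_boundedZ 4^-1 (torus_bounded_sqr bv)).
  rewrite RintegralD//; last exact: (integrableD _ iubv iv4).
  have -> : \int[T]_x ((u x - b x) * v x + 4^-1 * v x ^+ 2) =
      \int[T]_x ((u x - b x) * v x) + 4^-1 * \int[T]_x (v x ^+ 2).
    by rewrite RintegralD// RintegralZl.
  rewrite -/D; lra.
have rH : r * H <= k * H ^+ 2 + 4^-1 * a.
  have k40 : 0 < 4 * k by lra.
  rewrite -(ler_pM2l k40).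
  have -> : 4 * k * (k * H ^+ 2 + 4^-1 * a) = (2 * k * H) ^+ 2 + r ^+ 2 by rewrite r2; field.
  by have := sqr_ge0 (r - 2 * k * H); nra.
have := le_trans (ler_norm _) uvr; lra.
Qed.

Definition truncate (M : R) u x : R := Num.max (- M) (Num.min M (u x)).

Lemma maxr_lipschitz (c s t : R) : `|Num.max c s - Num.max c t| <= `|s - t|.
Proof.
have h0 := normr_ge0 (s - t); have h1 := ler_norm (s - t).
have h2 := ler_norm (t - s); rewrite distrC in h2.
rewrite ler_norml; case: (leP c s) => hs; case: (leP c t) => ht; apply/andP; split; lra.
Qed.

Lemma minr_lipschitz (c s t : R) : `|Num.min c s - Num.min c t| <= `|s - t|.
Proof.
have h0 := normr_ge0 (s - t); have h1 := ler_norm (s - t).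
have h2 := ler_norm (t - s); rewrite distrC in h2.
rewrite ler_norml; case: (leP c s) => hs; case: (leP c t) => ht; apply/andP; split; lra.
Qed.

Lemma truncate_lipschitz M u x y : `|truncate M u x - truncate M u y| <= `|u x - u y|.
Proof. exact: le_trans (maxr_lipschitz _ _ _) (minr_lipschitz _ _ _). Qed.

Lemma truncate_bounded M u : 0 <= M -> L2_torus u -> torus_bounded (truncate M u).
Proof.
move=> M0 [pu /[!inE]/andP[/[!inE]/= mu _]]; split.
  by move=> i x; rewrite /truncate pu.
split; last by exists M => x; rewrite ler_norml /truncate le_max lexx ge_max ge_min lexx andbT/=; lra.
apply: measurable_maxr; first exact: measurable_cst.
by apply: measurable_minr; first exact: measurable_cst.
Qed.

Lemma truncate_id M u x : `|u x| <= M -> truncate M u x = u x.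
Proof. by rewrite ler_norml => /andP[h1 h2]; rewrite /truncate min_r// max_r. Qed.

Lemma truncate_dist (M : R) u x : 0 <= M -> (u x - truncate M u x) ^+ 2 <= u x ^+ 2.
Proof.
move=> M0; rewrite /truncate; set t := u x.
by case: (leP M t) => h; [case: (leP (- M) M)|case: (leP (- M) t)] => h'; nra.
Qed.

(** Dominated convergence: the truncation error at x vanishes once the level exceeds
    |u x|, and its square is dominated by u^2. *)
Lemma truncate_cvg u (e : R) : L2_torus u -> 0 < e -> exists2 M : R, 0 <= M &
  T.-integrable [set: 'rV_n] (fun x => ((u x - truncate M u x) ^+ 2)%:E) /\
  \int[T]_x ((u x - truncate M u x) ^+ 2) <= e.
Proof.
move=> uL2 e0; have [pu /[!inE]/andP[/[!inE]/= mu _]] := uL2.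
have mt (k : nat) : measurable_fun [set: 'rV_n] (fun x => ((u x - truncate k%:R u x) ^+ 2)%:E).
  apply/measurable_EFinP; apply: measurable_funX; apply: measurable_funB => //.
  by case: (truncate_bounded (ler0n _ k) uL2) => _ [].
have iu2 := L2_torus_sqr_integrable uL2.
have it (k : nat) : T.-integrable [set: 'rV_n] (fun x => ((u x - truncate k%:R u x) ^+ 2)%:E).
  apply: (le_integrable measurableT _ _ iu2) => // x _.
  by rewrite !gee0_abs ?lee_fin ?sqr_ge0//; exact: truncate_dist.
have t0 x : [set: 'rV_n] x ->
    ((u x - truncate k%:R u x) ^+ 2)%:E @[k --> \oo] --> (cst 0%E x : \bar R).
  move=> _; apply: cvg_near_cst; exists (Num.truncn `|u x|).+1 => // k /= uk.
  rewrite truncate_id ?subrr ?expr0n//= ltW// (lt_le_trans (truncnS_gt _))//.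
  by rewrite ler_nat.
have tu k x : [set: 'rV_n] x ->
    (`|((u x - truncate k%:R u x) ^+ 2)%:E| <= (u x ^+ 2)%:E)%E.
  by move=> _; rewrite gee0_abs ?lee_fin ?sqr_ge0//; exact: truncate_dist.
have [_ _] := @dominated_convergence _ _ _ T _ measurableT _ _ _ mt (measurable_cst _)
  (aeW _ t0) iu2 (aeW _ (fun x k => tu k x)).
rewrite integral0 => /fine_cvgP[_ /cvgrPdist_le /(_ _ e0)[k _ /(_ k (leqnn k))]].
rewrite sub0r normrN => H; exists k%:R => //; split; first exact: it.
exact: le_trans (ler_norm _) H.
Qed.

End main_estimate.

(** * The interpolation inequality *)

(** The combination of four estimates, with U = |u|^2, X1 = |b - A b|^2,
    X2 = |A b|^2, X3 = |u - b|^2 and X4 = |b|^2, for b a truncation of u and A b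
    its averages. *)
Lemma interpolation_arith (K : realFieldType) (N P k k' H2 X1 X2 X3 X4 U e : K) :
  X1 <= N * P -> X2 <= 2 * k * H2 + 2 * X3 -> U <= 2 * X3 + 2 * X4 ->
  X4 <= 2 * X1 + 2 * X2 -> k * H2 <= k' * H2 -> X3 <= e / 10 ->
  U <= 4 * N * P + 8 * k' * H2 + e.
Proof. by move=> *; lra. Qed.

Section conclusion.
Context (K : realType) (n : nat) (rho : K -> K -> K).
Hypothesis rho_kernel : admissible_kernel n rho.
Notation T := (@torus K n).
Notation delta i := (delta_mx ord0 i : 'rV[K]_n).
Implicit Types u b : 'rV[K]_n -> K.

Lemma energy_ge0 eta u : 0 < eta -> Defs.periodic u -> measurable_fun [set: 'rV_n] u ->
  (0 <= energy rho eta u)%E.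
Proof.
move=> eta0 pu mu; rewrite (energyE rho_kernel)//.
apply: mule_ge0 => //; apply: integral_ge0 => z _.
rewrite mule_ge0 ?translation_defect_ge0// lee_fin.
exact: (kernel_ge0 rho_kernel).
Qed.

Lemma Hm1_norm_ge0 u : (0 <= Hm1_norm u)%E.
Proof.
have b0 : torus_bounded (fun _ : 'rV[K]_n => 0 : K).
  by split=> //; exact: bounded_measurable_cst.
have := @pairing_le_Hm1 K n u (fun=> 0) (fun _ _ => 0) 1 b0 (fun=> b0).
have -> : (fun x => (u x * 0)%:E) = cst 0%E :> ('rV[K]_n -> \bar K).
  by apply/funext => x; rewrite mulr0.
rewrite sqrtr1 mul1e => H; apply: le_trans (H _ _ _ _); first by rewrite lee_fin.
- move=> phi _ i; rewrite /Rintegral.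
  by rewrite !integral0_eq// ?oppr0// => x _; rewrite mul0r.
- exact: integrable0.
- exact: ltr01.
rewrite [X in _ + X]big1; last first.
  by move=> i _; rewrite /Rintegral integral0_eq// => x _; rewrite expr0n.
by rewrite addr0 /Rintegral integral0_eq// => x _; rewrite expr0n.
Qed.

(** Truncate u with squared error e / 10, which enters the final bound with the
    factor 2 + 2 * 2 * 2 = 10, apply the high and low frequency estimates with d = c / r
    to the truncation, and let e tend to 0. *)
Lemma interpolation_real (c C r E H : K) u :
  0 < c -> 0 < C -> 1 <= r -> L2_torus u ->
  (forall i t, `|t| <= c / r ->
     (translation_defect u (t *: delta i) <= (C / r ^+ 2)%:E * E%:E)%E) -> 0 <= E ->
  Hm1_norm u = H%:E ->
  \int[T]_x (u x ^+ 2) <= 4 ^+ n.+1 * (C / r ^+ 2 * E)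
    + 8 * (1 + n%:R * c ^- 2) * r ^+ 2 * H ^+ 2.
Proof.
move=> c0 C0 r1 uL2 uE E0 uH; have r0 : 0 < r by exact: lt_le_trans r1.
apply/ler_addgt0Pr => e e0.
have e10 : 0 < e / 10 by rewrite divr_gt0.
have [M M0 [iub ub]] := truncate_cvg uL2 e10.
set b := truncate M u in iub ub.
have bb : torus_bounded b by exact: truncate_bounded.
have iu2 := L2_torus_sqr_integrable uL2.
have ib2 := torus_integrable (torus_bounded_sqr bb).
pose d := c / r; have d0 : 0 < d by rewrite divr_gt0.
have B0 : 0 <= C / r ^+ 2 * E by rewrite mulr_ge0// divr_ge0 ?exprn_ge0// ltW.
have bdef i t : `|t| <= d -> \int[T]_x ((b (x + t *: delta i) - b x) ^+ 2) <= C / r ^+ 2 * E.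
  move=> td; rewrite -lee_fin RintegralE; last first.
    by apply: bounded_measurable_sqr; apply: bounded_measurableB;
      [exact: bounded_measurable_translate|exact: bb.2].
  rewrite EFinM; apply: le_trans (uE i t td); apply: ge0_le_integral.
  - exact: measurableT.
  - by move=> x _; rewrite lee_fin sqr_ge0.
  - by apply: measurable_diff_translate; exact: bb.2.1.
  - apply: measurable_diff_translate.
    by have [_ /[!inE]/andP[/[!inE]/= mu _]] := uL2.
  move=> x _; rewrite lee_fin -[leLHS]real_normK ?num_real// -[leRHS]real_normK ?num_real//.
  by rewrite ler_pXn2r ?nnegrE//; exact: truncate_lipschitz.
have h1 := averages_defect d0 (enum 'I_n) bb B0 bdef.
rewrite size_enum_ord in h1.
have h2 := averages_sqr_le d0 uL2 bb iub uH.
have bA := torus_bounded_averages d (enum 'I_n) bb.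
have sqsum (f g : 'rV[K]_n -> K) : T.-integrable [set: 'rV_n] (EFin \o (fun x => (f x - g x) ^+ 2)) ->
    T.-integrable [set: 'rV_n] (EFin \o (fun x => g x ^+ 2)) ->
    T.-integrable [set: 'rV_n] (EFin \o (fun x => f x ^+ 2)) ->
    \int[T]_x (f x ^+ 2) <= 2 * \int[T]_x ((f x - g x) ^+ 2) + 2 * \int[T]_x (g x ^+ 2).
  move=> ifg ig i_f.
  have i2 (h : 'rV[K]_n -> K) : T.-integrable [set: 'rV_n] (EFin \o h) ->
      T.-integrable [set: 'rV_n] (EFin \o (fun x => 2 * h x)).
    by move=> ih; exact: (integrableZl measurableT 2 ih).
  rewrite -!RintegralZl// -RintegralD//; try exact: i2.
  apply: le_Rintegral => //; first exact: (integrableD measurableT (i2 _ ifg) (i2 _ ig)).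
  by move=> x _; have := sqr_ge0 (f x - 2 * g x); nra.
have h3 := sqsum u b iub ib2 iu2.
have h4 := sqsum b _ (torus_integrable (torus_bounded_sqr (torus_boundedB bb bA)))
  (torus_integrable (torus_bounded_sqr bA)) ib2.
have kle : (1 + n%:R * d ^- 2) * H ^+ 2 <= (1 + n%:R * c ^- 2) * r ^+ 2 * H ^+ 2.
  rewrite ler_wpM2r ?sqr_ge0// mulrDl mul1r lerD ?exprn_ege1//.
  by rewrite /d expr_div_n invf_div mulrA mulrAC.
rewrite exprS -[8 * _ * _]mulrA; exact: (interpolation_arith h1 h2 h3 h4 kle ub).
Qed.

End conclusion.

Theorem theorem2p4 (K : realType) (n : nat) (rho : K -> K -> K)
    (n_gt0 : (0 < n)%N) (rho_kernel : admissible_kernel n rho) :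
  exists2 C : K, 0 < C &
    forall (R eta : K) (u : 'rV[K]_n -> K),
      1 <= R -> 0 < eta <= 1 / R -> L2_torus u ->
      (L2_norm u ^+ 2 <= (C / R ^+ 2)%:E * energy rho eta u
                         + (C * R ^+ 2)%:E * Hm1_norm u ^+ 2)%E.
Proof.
have [C1 C10 [c c0 H1]] := translation_defect_le n_gt0 rho_kernel.
pose C2 := 8 * (1 + n%:R * c ^- 2).
have C20 : 0 < C2.
  by rewrite mulr_gt0// ltr_pwDl// mulr_ge0// invr_ge0 exprn_ge0// ltW.
have C41 : 0 < 4 ^+ n.+1 * C1 by rewrite mulr_gt0// exprn_gt0.
exists (4 ^+ n.+1 * C1 + C2); first exact: addr_gt0.
move=> R eta u R1 /[dup] etaR /andP[eta0 _] uL2.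
have R0 : 0 < R by exact: lt_le_trans R1.
have [pu /[!inE]/andP[/[!inE]/= mu _]] := uL2.
set C := _ + C2; have C0 : 0 < C by exact: addr_gt0.
have E0 := energy_ge0 rho_kernel eta0 pu mu.
have H0 := Hm1_norm_ge0 u.
have CR : 0 < C / R ^+ 2 by rewrite divr_gt0// exprn_gt0.
have CR2 : 0 < C * R ^+ 2 by rewrite mulr_gt0// exprn_gt0.
have := fun i t => H1 R eta u i t R1 etaR pu mu.
move: E0; case: (energy rho eta u) => [E| |//] E0 uE; last first.
  (* Infinite energy: the right-hand side is infinite. *)
  rewrite gt0_muley ?lte_fin// addye ?leey// -ltNye.
  by apply: (lt_le_trans (ltNyr 0)); rewrite !mule_ge0// lee_fin ltW.
move: H0; case uH : (Hm1_norm u) => [H| |//] H0; last first.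
  (* Infinite dual norm: likewise. *)
  by rewrite mulyy gt0_muley ?lte_fin// addey ?leey// -EFinM.
have iu2 := L2_torus_sqr_integrable uL2.
rewrite -[(L2_norm u * _)%E]/(L2_norm u ^+ 2)%E L2_norm_sqr.
rewrite -(fineK (integrable_fin_num measurableT iu2)) -!EFinM -EFinD lee_fin -expr2.
rewrite lee_fin in E0.
apply: le_trans (interpolation_real c0 C10 R1 uL2 uE E0 uH) _.
have -> : 4 ^+ n.+1 * (C1 / R ^+ 2 * E) = 4 ^+ n.+1 * C1 / R ^+ 2 * E by rewrite !mulrA.
apply: lerD; rewrite ler_wpM2r ?sqr_ge0// ler_wpM2r ?invr_ge0 ?exprn_ge0 ?(ltW R0)//.
  by rewrite lerDl ltW.
by rewrite lerDr ltW.
Qed.
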